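(* Let $K=\mathbb{A}/\mathbb{Q}$, where $\mathbb{A}$ is the additive group of adeles of $\mathbb{Q}$, and let $g_1,\dots,g_d:\mathbb{Q}\to K$ be polynomials. If for any $(n_1,\dots,n_d)\in\mathbb{Q}^d\setminus\{0\}$ the sum $\sum_{j=1}^d n_jg_j:\mathbb{Q}\to K$ is not a constant map, then the map $(g_1,\dots,g_d):\mathbb{Q}\to K^d$ is well distributed.
   Context: $\mathbb{A}=\{(a_\infty,a_2,a_3,a_5,\dots)\in\mathbb{R}\times\prod_{p\text{ prime}}\mathbb{Q}_p: a_p\in\mathbb{Z}_p\text{ for all but finitely many }p\}$, with the topology generated by the sets $U_\infty\times\prod_{p\in F}U_p\times\prod_{p\notin F}\mathbb{Z}_p$ with $F$ a finite set of primes, $U_\infty\subset\mathbb{R}$ and $U_p\subset\mathbb{Q}_p$ open. $\mathbb{Q}$ is embedded diagonally in $\mathbb{A}$ as a discrete cocompact subgroup, and $K=\mathbb{A}/\mathbb{Q}$ is a compact abelian group; multiplication by rationals on $\mathbb{A}$ preserves $\mathbb{Q}$, so rationals act on $K$ by multiplication. A function $g:\mathbb{Q}\to K$ is a polynomial if it has the form $g(x)=\sum_{j=0}^m\alpha_jx^j$ (taken modulo $\mathbb{Q}$) for some $\alpha_0,\dots,\alpha_m\in\mathbb{A}$. A Følner sequence in (the discrete group) $(\mathbb{Q},+)$ is a sequence $(F_N)$ of non-empty finite subsets of $\mathbb{Q}$ with $|(x+F_N)\cap F_N|/|F_N|\to1$ for all $x\in\mathbb{Q}$. A map $v:\mathbb{Q}\to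 K^d$ is well distributed if for every Følner sequence $(F_N)$ in $(\mathbb{Q},+)$ it is uniformly distributed with respect to $(F_N)$, i.e. $\lim_{N\to\infty}\frac{|\{t\in F_N:v(t)\in U\}|}{|F_N|}=\mu(U)$ for every open $U\subset K^d$ whose boundary has measure $0$, where $\mu$ is the normalized Haar measure on $K^d$. *)

(* Defs.v *)
From HB Require Import structures.
From mathcomp Require Import all_boot all_order all_algebra finmap.
From mathcomp Require Import all_classical all_reals all_analysis.

Set Implicit Arguments.
Unset Strict Implicit.
Unset Printing Implicit Defensive.

Import Order.TTheory GRing.Theory Num.Theory.
Import numFieldNormedType.Exports.

Local Open Scope classical_set_scope.
Local Open Scope ring_scope.

Definition prime_number : Type := {p : nat | prime p}.

(* Z_p is the inverse limit of the rings Z/p^n.  An element is stored as the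
   sequence of its residues modulo p^n, each represented in [0, p^n); the
   coherence condition forces both the range and the compatibility. *)
Record padic_int (p : prime_number) := PadicInt {
  residue : nat -> int;
  residue_coherent :
    forall n, residue n = (residue n.+1 %% (sval p)%:Z ^+ n)%Z }.

HB.instance Definition _ p := gen_eqMixin (padic_int p).
HB.instance Definition _ p := gen_choiceMixin (padic_int p).

Section PadicIntRing.
Variable p : prime_number.
Local Notation Zp := (padic_int p).
Local Notation q n := ((sval p)%:Z ^+ n).
Implicit Types x y z : Zp.

Lemma padic_int_eq x y : (forall n, residue x n = residue y n) -> x = y.
Proof.
case: x y => [x hx] [y hy] /= /funext xy; case: _ / xy hy => hy.
by congr PadicInt; exact: Prop_irrelevance.
Qed.

Lemma modz_expS (m : int) n : ((m %% q n.+1)%Z = m %[mod q n])%Z.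
Proof.
have e : m = (m %/ q n.+1)%Z * sval p * q n + (m %% q n.+1)%Z.
  by rewrite -mulrA -exprS -divz_eq.
by rewrite [in RHS]e modzMDl.
Qed.

Lemma residue_mod x n : (residue x n %% q n)%Z = residue x n.
Proof. by rewrite residue_coherent modz_mod. Qed.

Lemma padic_limit_subproof (f : nat -> int) :
  (forall n, (f n.+1 = f n %[mod q n])%Z) ->
  forall n, (f n %% q n)%Z = ((f n.+1 %% q n.+1)%Z %% q n)%Z.
Proof. by move=> hf n; rewrite modz_expS hf. Qed.

Definition padic_limit f
    (hf : forall n, (f n.+1 = f n %[mod q n])%Z) : Zp :=
  PadicInt (padic_limit_subproof hf).

Lemma residueS_mod x n : (residue x n.+1 = residue x n %[mod q n])%Z.
Proof. by rewrite [in RHS]residue_coherent modz_mod. Qed.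

Lemma padic_const_subproof (m : int) n : (m = m %[mod q n])%Z.
Proof. by []. Qed.

Lemma padic_opp_subproof x n : (- residue x n.+1 = - residue x n %[mod q n])%Z.
Proof. by rewrite -modzNm residueS_mod modzNm. Qed.

Lemma padic_add_subproof x y n :
  (residue x n.+1 + residue y n.+1 = residue x n + residue y n %[mod q n])%Z.
Proof. by rewrite -modzDm !residueS_mod modzDm. Qed.

Lemma padic_mul_subproof x y n :
  (residue x n.+1 * residue y n.+1 = residue x n * residue y n %[mod q n])%Z.
Proof. by rewrite -modzMm !residueS_mod modzMm. Qed.

Definition padic_const m := padic_limit (padic_const_subproof m).
Definition padic_opp x := padic_limit (padic_opp_subproof x).
Definition padic_add x y := padic_limit (padic_add_subproof x y).
Definition padic_mul x y := padic_limit (padic_mul_subproof x y).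

Fact padic_addA : associative padic_add.
Proof.
by move=> x y z; apply: padic_int_eq => n /=; rewrite modzDml modzDmr addrA.
Qed.
Fact padic_addC : commutative padic_add.
Proof. by move=> x y; apply: padic_int_eq => n /=; rewrite addrC. Qed.
Fact padic_add0 : left_id (padic_const 0) padic_add.
Proof.
by move=> x; apply: padic_int_eq => n /=; rewrite mod0z add0r residue_mod.
Qed.
Fact padic_addN : left_inverse (padic_const 0) padic_opp padic_add.
Proof.
by move=> x; apply: padic_int_eq => n /=; rewrite modzDml addNr.
Qed.

HB.instance Definition _ := GRing.isZmodule.Build Zp
  padic_addA padic_addC padic_add0 padic_addN.

Fact padic_mulA : associative padic_mul.
Proof.
by move=> x y z; apply: padic_int_eq => n /=; rewrite modzMml modzMmr mulrA.
Qed.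
Fact padic_mulC : commutative padic_mul.
Proof. by move=> x y; apply: padic_int_eq => n /=; rewrite mulrC. Qed.
Fact padic_mul1 : left_id (padic_const 1) padic_mul.
Proof.
by move=> x; apply: padic_int_eq => n /=; rewrite modzMml mul1r residue_mod.
Qed.
Fact padic_mulDl : left_distributive padic_mul padic_add.
Proof.
move=> x y z; apply: padic_int_eq => n /=.
by rewrite modzMml mulrDl modzDml modzDmr.
Qed.
Fact padic_one_neq0 : padic_const 1 != 0.
Proof.
apply/eqP => /(congr1 (fun x => residue x 1)) /=; rewrite expr1 mod0z.
rewrite modz_small ?ltz_nat ?prime_gt1//; last exact: (svalP p).
Qed.

HB.instance Definition _ := GRing.Zmodule_isComNzRing.Build Zp
  padic_mulA padic_mulC padic_mul1 padic_mulDl padic_one_neq0.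

Definition padic_int_unit : {pred Zp} := fun x => `[< exists y, y * x = 1 >].

Definition padic_int_inv x : Zp := xget x [set y | y * x = 1].

Fact padic_int_mulV : {in padic_int_unit, left_inverse 1 padic_int_inv *%R}.
Proof. by move=> x /asboolP ex; exact: (xgetPex x ex). Qed.
Fact padic_int_unitP x y : y * x = 1 -> padic_int_unit x.
Proof. by move=> yx; apply/asboolP; exists y. Qed.
Fact padic_int_inv_out : {in [predC padic_int_unit], padic_int_inv =1 id}.
Proof.
move=> x /asboolPn nx; rewrite /padic_int_inv; case: xgetP => // y _ yx.
by case: nx; exists y.
Qed.

HB.instance Definition _ := GRing.ComNzRing_hasMulInverse.Build Zp
  padic_int_mulV padic_int_unitP padic_int_inv_out.

Lemma residue_modS x n k : ((residue x (n + k)%N) = residue x n %[mod q n])%Z.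
Proof.
elim: k => [|k IH]; first by rewrite addn0.
rewrite addnS -IH [in RHS]residue_coherent exprD.
have e : residue x (n + k).+1 = (residue x (n + k).+1 %/ (q n * q k))%Z * q k * q n
   + (residue x (n + k).+1 %% (q n * q k))%Z.
  by rewrite -mulrA [q k * q n]mulrC -divz_eq.
by rewrite [in LHS]e modzMDl.
Qed.

Fact padic_int_domain (x y : Zp) : x * y = 0 -> (x == 0) || (y == 0).
Proof.
move=> xy0; apply: contrapT => /negP; rewrite negb_or => /andP[x0 y0].
have [m xm] : exists m, residue x m <> 0.
  apply/existsNP => h; case/eqP: x0; apply: padic_int_eq => n.
  by rewrite h /= mod0z.
have [k yk] : exists k, residue y k <> 0.
  apply/existsNP => h; case/eqP: y0; apply: padic_int_eq => n.
  by rewrite h /= mod0z.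
have pp : prime (sval p) := svalP p.
have dvdE i (z : int) : (q i %| z)%Z = (sval p ^ i %| `|z|)%N.
  by rewrite dvdzE abszX.
have /dvdz_mod0P : ((residue x (m + k)%N * residue y (m + k)%N) %% q (m + k))%Z = 0.
  by have /(congr1 (fun z => residue z (m + k))) := xy0; rewrite /= mod0z.
have nx : ~~ (q m %| residue x (m + k)%N)%Z.
  apply/negP => /dvdz_mod0P; rewrite residue_modS residue_mod => /xm.
  by [].
have ny : ~~ (q k %| residue y (m + k)%N)%Z.
  apply/negP => /dvdz_mod0P; rewrite addnC residue_modS residue_mod => /yk.
  by [].
move: nx ny; rewrite !dvdE abszM.
set a := `|_|%N; set b := `|_|%N => nx ny.
have a0 : (0 < a)%N by case: a nx => //; rewrite dvdn0.
have b0 : (0 < b)%N by case: b ny => //; rewrite dvdn0.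
move: nx ny; rewrite !pfactor_dvdn ?muln_gt0 ?a0 ?b0// -!ltnNge lognM// => la lb.
by move=> /(leq_trans (leq_add la lb)); rewrite addSn addnS ltnNge leqnSn.
Qed.

HB.instance Definition _ :=
  GRing.ComUnitRing_isIntegral.Build Zp padic_int_domain.

Lemma residue_nat m n : residue (m%:R : Zp) n = (m%:Z %% q n)%Z.
Proof.
elim: m => [|m IH]; first by [].
by rewrite -addn1 natrD /= IH modzDm -PoszD.
Qed.

Lemma natr_padic_int_eq0 m : (m%:R == 0 :> Zp) = (m == 0%N).
Proof.
apply/eqP/eqP => [m0|->//].
have /(congr1 (fun z => residue z m)) := m0.
rewrite residue_nat /= mod0z modz_small; first by case.
have -> : q m = (sval p ^ m)%N%:Z by rewrite -!natz natrX.
by rewrite ltz_nat ltn_expl// prime_gt1//; exact: (svalP p).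
Qed.

Lemma natr_padic_int_unit m : ~~ (sval p %| m)%N -> (m%:R : Zp) \is a GRing.unit.
Proof.
move=> pm; have pp : prime (sval p) := svalP p.
have cop n : coprimez m%:Z (q n).
  rewrite coprimezE abszX; apply: coprimeXr.
  by rewrite coprime_sym prime_coprime.
have inv n : exists u : int, (u * m%:Z = 1 %[mod q n])%Z.
  have [u [v uv]] := Bezoutz m%:Z (q n).
  by exists u; rewrite -(eqP (cop n)) -uv addrC modzMDl.
pose u n := projT1 (cid (inv n)).
have uP n : (u n * m%:Z = 1 %[mod q n])%Z by rewrite /u; case: cid.
have uS n : (u n.+1 = u n %[mod q n])%Z.
  apply/eqP; rewrite eqz_mod_dvd -(@Gauss_dvdzl _ _ m%:Z).
    rewrite mulrBl -eqz_mod_dvd uP; apply/eqP.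
    by rewrite -modz_expS uP modz_expS.
  by rewrite coprimez_sym.
apply/unitrPr; exists (padic_limit uS); rewrite mulrC.
by apply: padic_int_eq => n /=; rewrite residue_nat modzMm uP.
Qed.

End PadicIntRing.

Definition padic (p : prime_number) : Type := {fraction padic_int p}.

HB.instance Definition _ p := GRing.Field.on (padic p).

Definition padic_of_int p (z : padic_int p) : padic p := tofrac z.

Definition padic_integers p : set (padic p) := range (@padic_of_int p).

(* The topology of the p-adic absolute value, whose balls around x are the
   sets x + p^n Z_p. *)
Definition padic_open p (U : set (padic p)) : Prop :=
  forall x, U x -> exists n : nat, forall z : padic_int p,
    U (x + (sval p)%:R ^+ n * padic_of_int z).

Fact padic_openT p : padic_open [set: padic p].
Proof. by move=> x _; exists 0%N. Qed.

Lemma padic_ball_sub p (x : padic p) m k U :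
  (forall z : padic_int p, U (x + (sval p)%:R ^+ m * padic_of_int z)) ->
  forall z : padic_int p, U (x + (sval p)%:R ^+ (m + k) * padic_of_int z).
Proof.
move=> h z; have := h ((sval p)%:R ^+ k * z).
by rewrite /padic_of_int rmorphM rmorphXn rmorph_nat exprD mulrA.
Qed.

Fact padic_openI p : setI_closed (@padic_open p).
Proof.
move=> A B oA oB x [/oA[m hm] /oB[k hk]]; exists (m + k)%N => z; split.
  exact: (@padic_ball_sub _ _ m k A).
by rewrite addnC; exact: (@padic_ball_sub _ _ k m B).
Qed.

Fact padic_open_bigU p (I : Type) (f : I -> set (padic p)) :
  (forall i, padic_open (f i)) -> padic_open (\bigcup_i f i).
Proof.
by move=> h x [i _ /h[n hn]]; exists n => z; exists i => //; exact: hn.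
Qed.

HB.instance Definition _ p := isOpenTopological.Build (padic p)
  (@padic_openT p) (@padic_openI p) (@padic_open_bigU p).

Lemma natr_padic_eq0 p m : (m%:R == 0 :> padic p) = (m == 0%N).
Proof. by rewrite -(rmorph_nat (@tofrac (padic_int p))) tofrac_eq0 natr_padic_int_eq0. Qed.

Lemma natr_padic_integersV p m : ~~ (sval p %| m)%N ->
  padic_integers ((m%:R : padic p)^-1).
Proof.
move=> /natr_padic_int_unit um; exists (m%:R^-1) => //.
by rewrite /padic_of_int rmorphV// rmorph_nat.
Qed.

Lemma padic_integersM p (x y : padic p) :
  padic_integers x -> padic_integers y -> padic_integers (x * y).
Proof.
by move=> [z _ <-] [t _ <-]; exists (z * t); rewrite // /padic_of_int rmorphM.
Qed.

Lemma padic_integersD p (x y : padic p) :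
  padic_integers x -> padic_integers y -> padic_integers (x + y).
Proof.
by move=> [z _ <-] [t _ <-]; exists (z + t); rewrite // /padic_of_int rmorphD.
Qed.

Lemma padic_integersN p (x : padic p) :
  padic_integers x -> padic_integers (- x).
Proof.
by move=> [z _ <-]; exists (- z); rewrite // /padic_of_int rmorphN.
Qed.

Lemma padic_integers_int p (m : int) : padic_integers (m%:~R : padic p).
Proof. by exists (m%:~R); rewrite // /padic_of_int rmorph_int. Qed.

(* ratr is known to the library to be a ring morphism only into ordered
   fields; these lemmas give it for Q_p. *)
Section RatPadic.
Variable p : prime_number.
Local Notation F := (padic p).

Lemma intr_padic_eq0 (m : int) : (m%:~R == 0 :> F) = (m == 0).
Proof.
by case: m => n; rewrite ?NegzE ?rmorphN /= ?oppr_eq0 natr_padic_eq0.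
Qed.

Lemma padic_ratrE (m d : int) : d != 0 ->
  ratr (m%:~R / d%:~R) = m%:~R / d%:~R :> F.
Proof.
move=> d0; set x : rat := _ / _.
have e : numq x * d = m * denq x.
  apply: (@intr_inj rat); rewrite !rmorphM /= numqE.
  have -> : m%:~R = x * d%:~R by rewrite /x divfK ?intr_eq0.
  by rewrite mulrAC.
rewrite /ratr; apply/eqP; rewrite eqr_div ?intr_padic_eq0 ?denq_neq0//.
by rewrite -!rmorphM /= e.
Qed.

Lemma ratr_padicD (x y : rat) : ratr (x + y) = ratr x + ratr y :> F.
Proof.
have nz (z : rat) : (denq z)%:~R != 0 :> F by rewrite intr_padic_eq0 denq_neq0.
have -> : x + y = (numq x * denq y + numq y * denq x)%:~R / (denq x * denq y)%:~R.
  rewrite rmorphD !rmorphM /= -[LHS]/(x + y) -[x in LHS]divq_num_den.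
  by rewrite -[y in LHS]divq_num_den addf_div ?intr_eq0 ?denq_neq0.
rewrite padic_ratrE ?mulf_neq0 ?denq_neq0// /ratr addf_div//.
by rewrite rmorphD !rmorphM.
Qed.

Lemma ratr_padicM (x y : rat) : ratr (x * y) = ratr x * ratr y :> F.
Proof.
have -> : x * y = (numq x * numq y)%:~R / (denq x * denq y)%:~R.
  rewrite !rmorphM /= -[x in LHS]divq_num_den.
  by rewrite -[y in LHS]divq_num_den mulf_div.
rewrite padic_ratrE ?mulf_neq0 ?denq_neq0// /ratr mulf_div.
by rewrite !rmorphM.
Qed.

Lemma ratr_padic1 : ratr 1 = 1 :> F.
Proof. by rewrite /ratr divr1. Qed.

Lemma ratr_padic_integers (x : rat) : ~~ (sval p %| `|denq x|)%N ->
  padic_integers (ratr x : F).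
Proof.
move=> pd; apply: padic_integersM; first exact: padic_integers_int.
have -> : (denq x)%:~R = `|denq x|%N%:R :> F by rewrite pmulrn gez0_abs ?denq_ge0.
exact: natr_padic_integersV.
Qed.

End RatPadic.

Lemma finite_prime_divisors (n : nat) : (0 < n)%N ->
  finite_set [set p : prime_number | (sval p %| n)%N].
Proof.
move=> n0.
apply: (@sub_finite_set _ _ (sval @^-1` `I_n.+1)).
  by move=> p /= /dvdn_leq; rewrite ltnS; exact.
apply: finite_preimage; last exact: finite_II.
by move=> p1 p2 _ _; exact: val_inj.
Qed.

Record adele (R : realType) := Adele {
  adele_inf : R;
  adele_fin : forall p : prime_number, padic p;
  adele_finP : finite_set [set p | ~ padic_integers (adele_fin p)] }.

HB.instance Definition _ R := gen_eqMixin (adele R).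
HB.instance Definition _ R := gen_choiceMixin (adele R).

Section AdeleGroup.
Variable R : realType.
Local Notation A := (adele R).
Implicit Types (a b c : A) (x y : rat).

Lemma adele_eq a b : adele_inf a = adele_inf b ->
  (forall p, adele_fin a p = adele_fin b p) -> a = b.
Proof.
case: a b => [a1 a2 a3] [b1 b2 b3] /= -> ab.
have e : a2 = b2 by exact: functional_extensionality_dep.
by move: a3; rewrite e => a3; congr Adele; exact: Prop_irrelevance.
Qed.

Fact adele_diag_finP x :
  finite_set [set p | ~ padic_integers (ratr x : padic p)].
Proof.
have := @finite_prime_divisors `|denq x|%N _.
rewrite absz_gt0 denq_neq0 => /(_ isT); apply: sub_finite_set => p /=.
by apply: contra_notT; exact: ratr_padic_integers.
Qed.

Definition adele_diag x : A := Adele (ratr x) (adele_diag_finP x).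

Fact adele_opp_finP a :
  finite_set [set p | ~ padic_integers (- adele_fin a p)].
Proof.
apply: sub_finite_set (adele_finP a) => p /=.
by apply: contra_not; exact: padic_integersN.
Qed.

Fact adele_add_finP a b :
  finite_set [set p | ~ padic_integers (adele_fin a p + adele_fin b p)].
Proof.
have : finite_set ([set p | ~ padic_integers (adele_fin a p)] `|`
                   [set p | ~ padic_integers (adele_fin b p)]).
  by rewrite finite_setU; split; exact: adele_finP.
apply: sub_finite_set => p /= nab; apply/not_andP => -[pa pb].
by apply: nab; exact: padic_integersD.
Qed.

Fact adele_scale_finP x a :
  finite_set [set p | ~ padic_integers (ratr x * adele_fin a p)].
Proof.
have : finite_set ([set p | ~ padic_integers (ratr x : padic p)] `|`
                   [set p | ~ padic_integers (adele_fin a p)]).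
  by rewrite finite_setU; split; [exact: adele_diag_finP|exact: adele_finP].
apply: sub_finite_set => p /= nab; apply/not_andP => -[pa pb].
by apply: nab; exact: padic_integersM.
Qed.

Definition adele_opp a := Adele (- adele_inf a) (adele_opp_finP a).
Definition adele_add a b :=
  Adele (adele_inf a + adele_inf b) (adele_add_finP a b).
Definition adele_scale x a :=
  Adele (ratr x * adele_inf a) (adele_scale_finP x a).

Fact adele_addA : associative adele_add.
Proof. by move=> a b c; apply: adele_eq => [|p] /=; rewrite addrA. Qed.
Fact adele_addC : commutative adele_add.
Proof. by move=> a b; apply: adele_eq => [|p] /=; rewrite addrC. Qed.
Fact adele_add0 : left_id (adele_diag 0) adele_add.
Proof.
by move=> a; apply: adele_eq => [|p] /=; rewrite /ratr mul0r add0r.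
Qed.
Fact adele_addN : left_inverse (adele_diag 0) adele_opp adele_add.
Proof.
by move=> a; apply: adele_eq => [|p] /=; rewrite addNr /ratr mul0r.
Qed.

HB.instance Definition _ := GRing.isZmodule.Build A
  adele_addA adele_addC adele_add0 adele_addN.

Fact adele_scaleA x y a :
  adele_scale x (adele_scale y a) = adele_scale (x * y) a.
Proof.
apply: adele_eq => [|p] /=; first by rewrite rmorphM mulrA.
by rewrite ratr_padicM mulrA.
Qed.
Fact adele_scale1 : left_id 1 adele_scale.
Proof.
move=> a; apply: adele_eq => [|p] /=; first by rewrite rmorph1 mul1r.
by rewrite ratr_padic1 mul1r.
Qed.
Fact adele_scaleDr : right_distributive adele_scale +%R.
Proof. by move=> x a b; apply: adele_eq => [|p] /=; rewrite mulrDr. Qed.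
Fact adele_scaleDl a : {morph adele_scale^~ a : x y / x + y}.
Proof.
move=> x y; apply: adele_eq => [|p] /=; first by rewrite rmorphD mulrDl.
by rewrite ratr_padicD mulrDl.
Qed.

HB.instance Definition _ := GRing.Zmodule_isLmodule.Build rat A
  adele_scaleA adele_scale1 adele_scaleDr adele_scaleDl.

Definition adele_box (Uinf : set R) (F : set prime_number)
    (U : forall p, set (padic p)) : set A :=
  [set a | Uinf (adele_inf a) /\
    forall p, (F p -> U p (adele_fin a p)) /\
              (~ F p -> padic_integers (adele_fin a p))].

Definition adele_boxes : set (set A) :=
  [set B | exists Uinf F U, [/\ open Uinf, finite_set F,
    forall p, F p -> open (U p) & B = adele_box Uinf F U]].

HB.instance Definition _ := isPointed.Build A 0.
HB.instance Definition _ := isSubBaseTopological.Build A adele_boxes id.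

Definition adele_rational : {pred A} :=
  fun a => `[< exists x, a = adele_diag x >].

Fact adele_rational_zmod_closed : zmod_closed adele_rational.
Proof.
split; first by apply/asboolP; exists 0.
move=> a b /asboolP[x ->] /asboolP[y ->]; apply/asboolP; exists (x - y).
apply: adele_eq => [|p] /=; first by rewrite rmorphB.
by apply/eqP; rewrite subr_eq -ratr_padicD subrK.
Qed.

HB.instance Definition _ :=
  GRing.isZmodClosed.Build A adele_rational adele_rational_zmod_closed.

Definition adele_quot : Type := {ideal_quot adele_rational}.

HB.instance Definition _ := GRing.Zmodule.on adele_quot.
HB.instance Definition _ := isPointed.Build adele_quot 0.

Definition adele_proj (a : A) : adele_quot :=
  (\pi_{ideal_quot adele_rational} a)%qT.

(* The library's quotient_topology would equip this type with a second
   choiceType structure, so the quotient topology is declared directly. *)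
Definition adele_quot_open (U : set adele_quot) : Prop :=
  open (adele_proj @^-1` U).

Fact adele_quot_openT : adele_quot_open setT.
Proof. by rewrite /adele_quot_open preimage_setT; exact: openT. Qed.
Fact adele_quot_openI : setI_closed adele_quot_open.
Proof. by move=> U V; exact: openI. Qed.
Fact adele_quot_open_bigU (I : Type) (f : I -> set adele_quot) :
  (forall i, adele_quot_open (f i)) -> adele_quot_open (\bigcup_i f i).
Proof.
by move=> h; rewrite /adele_quot_open preimage_bigcup; 
apply: bigcup_open => i _; exact: h.
Qed.

HB.instance Definition _ := isOpenTopological.Build adele_quot
  adele_quot_openT adele_quot_openI adele_quot_open_bigU.

Lemma adele_proj_repr (k : adele_quot) : adele_proj (repr k) = k.
Proof. exact: reprK. Qed.

Lemma adele_proj_eq a b :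
  adele_proj a = adele_proj b <-> exists x, a - b = adele_diag x.
Proof.
have E : (a - b \in adele_rational) = (adele_proj a == adele_proj b).
  exact: Quotient.idealrBE.
split=> [/eqP|ab]; first by rewrite -E => /asboolP.
by apply/eqP; rewrite -E; apply/asboolP.
Qed.

Lemma adele_projD : {morph adele_proj : a b / a + b}.
Proof. exact: (raddfD (\pi_{ideal_quot adele_rational})%qT). Qed.

Definition adele_quot_scale x (k : adele_quot) : adele_quot :=
  adele_proj (x *: repr k).

Lemma adele_quot_scaleE x a :
  adele_quot_scale x (adele_proj a) = adele_proj (x *: a).
Proof.
apply/adele_proj_eq; rewrite -scalerBr.
have /adele_proj_eq[y ->] := adele_proj_repr (adele_proj a).
exists (x * y); apply: adele_eq => [|p] /=; first by rewrite rmorphM.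
by rewrite ratr_padicM.
Qed.

Fact adele_quot_scaleA x y k :
  adele_quot_scale x (adele_quot_scale y k) = adele_quot_scale (x * y) k.
Proof. by rewrite [adele_quot_scale y k]/adele_quot_scale adele_quot_scaleE scalerA. Qed.
Fact adele_quot_scale1 : left_id 1 adele_quot_scale.
Proof. by move=> k; rewrite /adele_quot_scale scale1r adele_proj_repr. Qed.
Fact adele_quot_scaleDr : right_distributive adele_quot_scale +%R.
Proof.
move=> x k l; rewrite -(adele_proj_repr k) -(adele_proj_repr l) -adele_projD.
by rewrite !adele_quot_scaleE scalerDr adele_projD.
Qed.
Fact adele_quot_scaleDl k : {morph adele_quot_scale^~ k : x y / x + y}.
Proof. by move=> x y; rewrite /adele_quot_scale scalerDl adele_projD. Qed.

HB.instance Definition _ := GRing.Zmodule_isLmodule.Build rat adele_quot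
  adele_quot_scaleA adele_quot_scale1 adele_quot_scaleDr adele_quot_scaleDl.

End AdeleGroup.

Definition polynomial_map (R : realType) (g : rat -> adele_quot R) : Prop :=
  exists (m : nat) (alpha : 'I_m.+1 -> adele R),
    forall x, g x = adele_proj (\sum_(j < m.+1) x ^+ j *: alpha j).

Definition translate (x : rat) (F : {fset rat}) : {fset rat} :=
  [fset (x + t)%R | t in F]%fset.

Definition folner_sequence (R : realType) (F : nat -> {fset rat}) : Prop :=
  (forall N, F N != fset0) /\
  forall x : rat,
    (fun N => #|` (translate x (F N) `&` F N)%fset|%:R / #|` F N|%:R : R)
      @ \oo --> (1 : R).

Section WellDistributed.
Variables (R : realType) (d : nat).

(* The library's topology on row vectors is the entrywise (product) one. *)
Local Notation Kd := ('rV[adele_quot R]_d).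
Local Notation BKd := (g_sigma_algebraType (@open Kd)).

(* K^d is compact and metrizable, so every Borel probability measure on it is
   regular and no regularity clause is needed: this determines mu uniquely. *)
Definition normalized_haar (mu : probability BKd R) : Prop :=
  forall (x : Kd) (B : set BKd), measurable B ->
    mu [set x + y | y in (B : set Kd)] = mu B.

Definition uniformly_distributed (mu : probability BKd R) (v : rat -> Kd)
    (F : nat -> {fset rat}) : Prop :=
  forall U : set Kd, open U -> mu (closure U `\` interior U) = 0%E ->
    (fun N => (#|` [fset t in F N | v t \in U]%fset|%:R
               / #|` F N|%:R : R)%:E) @ \oo --> mu U.

Definition well_distributed (mu : probability BKd R) (v : rat -> Kd) : Prop :=
  forall F, folner_sequence R F -> uniformly_distributed mu v F.

End WellDistributed.

(* Main.v *)
Require Import Defs.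
From HB Require Import structures.
From mathcomp Require Import all_boot all_order all_algebra finmap.
From mathcomp Require Import all_classical all_reals all_analysis.
From mathcomp Require Import complex.
From mathcomp Require Import ring lra zify.
Set Implicit Arguments.
Unset Strict Implicit.
Unset Printing Implicit Defensive.

Import Order.TTheory GRing.Theory Num.Theory.
Import numFieldNormedType.Exports.

Local Open Scope classical_set_scope.
Local Open Scope ring_scope.

(** This is Weyl's criterion on the solenoid.  Write [e x] for
    [exp (2 i pi x)].  Every adele is the sum of a rational and of an integral
    adele, one whose [p]-component lies in [Z_p] for all [p]
    ([adele_integral_part]).  Two integral adeles with the same class in [K]
    differ by an integer, so sending the class of an integral adele [a] to
    [e a_oo] defines a character [adele_char] of [K].  The characters of [K^d]
    that matter are the [adele_char (\sum_j n_j *: k_j)] with [n] a rational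
    vector.

    Exponential sums.  The rationals are their own annihilator
    ([adele_char_separates]): if [b] is not rational, then
    [adele_char (t *: b)] is a nontrivial character of the group of rationals
    [t], and its means along a Folner sequence tend to [0] because Folner sets
    are almost invariant under translation.  Differencing a polynomial lowers
    its degree and multiplies its leading coefficient by a nonzero rational, so
    a leading coefficient outside the rationals stays outside, and
    [van_der_corput] extends the result to all degrees.  Rational coefficients
    vanish modulo the rationals; hence the means of [adele_char (g t)] tend to
    [0] for every polynomial [g] that is not constant
    ([nonconstant_phase_vanishing]).  By hypothesis this applies to all
    nontrivial rational combinations of the [g_j].

    From characters to open sets.  For a natural number [N], the values
    [adele_char (k_j / N)] map [K^d] to a torus, and the preimages of small
    balls for divisible [N] form a base of neighbourhoods.  Take an open set
    [U] and a grid of [M ^ d] points on that torus, and select the grid points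
    around which a ball of radius [delta] is contained in [U].  Averaging
    products of Fejer kernels centred at the selected points gives
    a trigonometric polynomial which is at most the indicator of [U] up to an
    error [4 d / (M delta ^ 2)], and whose means tend to the proportion of
    selected points.  This bounds the frequency of visits to [U] from below
    ([frequency_lower_bound]).  The half-open cells attached to the grid points
    are disjoint translates of each other, so the invariant measure of each is
    at most [1 / M ^ d]; along [N = n!] every point of [U] ends up in selected
    cells, so the proportion of selected points can be made at least
    [mu U - e] ([inner_cells]).

    So the lower limit of the frequencies is at least [mu U] for every open
    [U].  If the boundary of [U] is null, the same bound for the exterior of
    [U] gives the matching upper limit. *)

(** * The exponential on the unit circle *)

Section UnitExp.
Variable R : realType.
Implicit Types x y : R.
Local Open Scope complex_scope.

Definition unit_exp x : R[i] := cos (pi *+ 2 * x) +i* sin (pi *+ 2 * x).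

Lemma unit_expD x y : unit_exp (x + y) = unit_exp x * unit_exp y.
Proof.
rewrite /unit_exp mulrDr cosD sinD; apply/eqP; rewrite eq_complex /=.
by rewrite eqxx /= addrC.
Qed.

Lemma unit_exp0 : unit_exp 0 = 1.
Proof. by rewrite /unit_exp mulr0 cos0 sin0. Qed.

Lemma norm_unit_exp x : `|unit_exp x| = 1.
Proof. by rewrite normc_def /= cos2Dsin2 sqrtr1. Qed.

Lemma unit_exp_neq0 x : unit_exp x != 0.
Proof. by rewrite -normr_gt0 norm_unit_exp. Qed.

Lemma unit_expN x : unit_exp (- x) = (unit_exp x)^-1.
Proof.
apply: (mulfI (unit_exp_neq0 x)).
by rewrite -unit_expD subrr unit_exp0 divff ?unit_exp_neq0.
Qed.

Lemma unit_exp1 : unit_exp 1 = 1.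
Proof. by rewrite /unit_exp mulr1 cos2pi sin2pi. Qed.

Lemma unit_expMn x n : unit_exp (x *+ n) = unit_exp x ^+ n.
Proof.
elim: n => [|n IH]; first by rewrite mulr0n unit_exp0.
by rewrite mulrS unit_expD IH exprS.
Qed.

Lemma unit_exp_int (m : int) : unit_exp m%:~R = 1.
Proof.
case: m => n; rewrite ?NegzE ?rmorphN /= ?unit_expN -pmulrn unit_expMn;
  rewrite unit_exp1 expr1n //.
by rewrite invr1.
Qed.

(** After subtracting the nearest integer, [x] lies in [[-1/2, 1/2]], where the
    cosine of [2 pi |x|] is decreasing: this is what turns closeness of
    characters to [1] into closeness of real components. *)
Lemma unit_exp_near1 (eta : R) : 0 < eta ->
  exists2 delta : R, 0 < delta &
    forall x, `|unit_exp x - 1| < delta%:C ->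
      exists m : int, `|x - m%:~R| < eta.
Proof.
move=> eta0; pose h := Num.min eta (2^-1).
have pi0 := @pi_gt0 R.
have h0 : 0 < h by rewrite lt_min eta0 invr_gt0 ltr0n.
have h1 : h <= 2^-1 by rewrite ge_min lexx orbT.
have h2 : h <= eta by rewrite ge_min lexx.
exists (1 - cos (pi *+ 2 * h)).
  rewrite subr_gt0 -[X in _ < X]cos0 ltr_cos ?in_itv /= ?lexx ?pi_ge0 //; nra.
move=> x near1; exists (Num.floor (x + 2^-1)).
set m := Num.floor _; set y := x - _.
have /andP[m1 m2] := floor_itv (x + 2^-1).
have ex : unit_exp x = unit_exp y.
  by rewrite -[x](subrK m%:~R) unit_expD unit_exp_int mulr1.
move: near1; apply: contraTT => yeta; rewrite -leNgt in yeta; rewrite ex.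
have {}yeta : h <= `|y| by exact: le_trans yeta.
have y1 : `|y| <= 2^-1.
  move: m1 m2; rewrite intrD -/m /y => m1 m2; rewrite ler_norml; lra.
apply/negP => /(le_lt_trans (normc_ge_Re _)); apply/negP.
rewrite ltcR -leNgt /= -[cos (_ * y)]cos_norm.
rewrite normrM (ger0_norm (_ : 0 <= pi *+ 2)); last by lra.
rewrite distrC; apply: le_trans (ler_norm _); rewrite lerD2l lerN2.
by rewrite leNgt ltr_cos ?in_itv /= -?leNgt; first nra; apply/andP; split; nra.
Qed.

(** A point strictly between two consecutive integers keeps a positive distance
    to all integers. *)
Lemma unit_exp_eq1 x : unit_exp x = 1 -> exists m : int, x = m%:~R.
Proof.
move=> x1; apply: contrapT => /forallNP xm.
pose m := Num.floor x; have /andP[m1 m2] := floor_itv x.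
have {}m1 : m%:~R < x by rewrite lt_neqAle m1 andbT; apply/eqP => /esym/xm.
pose eta := Num.min (x - m%:~R) ((m + 1)%:~R - x).
have eta0 : 0 < eta by rewrite lt_min !subr_gt0 m1 m2.
have [d d0 /(_ x)] := unit_exp_near1 eta0.
rewrite x1 subrr normr0 (ltcR 0) d0 => /(_ isT)[n].
rewrite lt_min => /andP[h1 h2]; have [nm|] := leP n m.
  have : n%:~R <= m%:~R :> R by rewrite ler_int.
  by move: h1; rewrite ltr_norml => /andP[_]; lra.
rewrite -lezD1 -(ler_int R); move: h2; rewrite ltr_norml => /andP[]; lra.
Qed.

(** On the unit circle [|e x - 1| ^ 2 = 2 (1 - cos (2 pi x))]. *)
Lemma unit_exp_continuous0 (delta : R) : 0 < delta ->
  exists2 eta : R, 0 < eta &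
    forall x, `|x| < eta -> `|unit_exp x - 1| < delta%:C.
Proof.
move=> d0.
have hc : (cos y) @[y --> (0:R)] --> (1 : R).
  by rewrite -[X in _ --> X]cos0; exact: continuous_cos.
have d2 : 0 < delta ^+ 2 / 2 by rewrite divr_gt0 // exprn_gt0.
have [e /= e0 he] : \forall y \near (0 : R), `|1 - cos y| < delta ^+ 2 / 2.
  by move/cvgrPdist_lt: hc; exact.
have p2 : 0 < pi *+ 2 :> R by rewrite pmulrn_rgt0 // pi_gt0.
exists (e / (pi *+ 2)); first by rewrite divr_gt0.
move=> x xe; rewrite normc_def /= ltcR .
have /he : ball_ Num.norm 0 e (pi *+ 2 * x).
  by rewrite /= sub0r normrN normrM gtr0_norm // mulrC -ltr_pdivlMr.
rewrite /= => h; rewrite -(gtr0_norm d0) -sqrtr_sqr ltr_sqrt ?exprn_gt0 //.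
have := cos2Dsin2 (pi *+ 2 * x); have := ler_norm (1 - cos (pi *+ 2 * x)).
by rewrite oppr0 addr0; nra.
Qed.

End UnitExp.

(** * Means along Folner sequences *)

Section Vanishing.
Variable R : realType.
Local Open Scope complex_scope.
Implicit Types (f g : nat -> R[i]).

Definition vanishing f :=
  forall e : R, 0 < e -> \forall N \near \oo, `|f N| <= e%:C.

Lemma vanishing_ext f g : f =1 g -> vanishing g -> vanishing f.
Proof. by move=> /funext ->. Qed.

Lemma vanishing0 : vanishing (fun=> 0).
Proof. by move=> e e0; apply: nearW => N; rewrite normr0 ler0c ltW. Qed.

Lemma vanishingD f g : vanishing f -> vanishing g ->
  vanishing (fun N => f N + g N).
Proof.
move=> f0 g0 e e0; have e2 : 0 < e / 2 by rewrite divr_gt0.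
apply: filterS2 (f0 _ e2) (g0 _ e2) => N fN gN.
rewrite [e]splitr rmorphD /=; apply: le_trans (ler_normD _ _) (lerD fN gN).
Qed.

Lemma vanishingZ (c : R[i]) f : vanishing f -> vanishing (fun N => c * f N).
Proof.
move=> f0 e e0.
have [k kc] : exists k : R, `|c| = k%:C by rewrite normc_def; eexists.
have k0 : 0 <= k by rewrite -ler0c -kc.
have k1 : 0 < k + 1 by apply: ltr_wpDl.
apply: filterS (f0 _ (divr_gt0 e0 k1)) => N fN; rewrite normrM kc.
apply: le_trans (ler_wpM2l _ fN) _; first by rewrite ler0c.
by rewrite -rmorphM lecR mulrCA ger_pMr // ler_pdivrMr // mul1r lerDl.
Qed.

Lemma vanishing_sum (I : Type) (r : seq I) (P : pred I) (f : I -> nat -> R[i]) :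
  (forall i, P i -> vanishing (f i)) ->
  vanishing (fun N => \sum_(i <- r | P i) f i N).
Proof.
move=> f0; elim: r => [|i r IH].
  by apply: vanishing_ext vanishing0 => N; rewrite big_nil.
under [X in vanishing X]eq_fun do rewrite big_cons.
by case Pi: (P i) => //; apply: vanishingD => //; exact: f0.
Qed.

End Vanishing.

Section Mean.
Variable R : realType.
Local Open Scope complex_scope.
Implicit Types (A B : {fset rat}) (u v : rat -> R[i]).

Definition mean A u : R[i] := (\sum_(t <- A) u t) / #|` A|%:R.

Lemma mean_const A (c : R[i]) : A != fset0 -> mean A (fun=> c) = c.
Proof.
move=> A0; rewrite /mean big_const_seq count_predT iter_addr_0 -[c *+ _]mulr_natr.
by rewrite mulfK // pnatr_eq0 cardfs_eq0.
Qed.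

Lemma mean_sum (I : Type) (r : seq I) (P : pred I) (f : I -> rat -> R[i]) A :
  mean A (fun t => \sum_(i <- r | P i) f i t) = \sum_(i <- r | P i) mean A (f i).
Proof. by rewrite /mean exchange_big mulr_suml. Qed.

Lemma meanD A u v : mean A (fun t => u t + v t) = mean A u + mean A v.
Proof. by rewrite /mean big_split mulrDl. Qed.

Lemma meanZ A (c : R[i]) u : mean A (fun t => c * u t) = c * mean A u.
Proof. by rewrite /mean -mulr_sumr mulrA. Qed.

Lemma mean_conj A u : mean A (fun t => (u t)^*%R) = (mean A u)^*%R.
Proof. by rewrite /mean rmorphM fmorphV rmorph_nat rmorph_sum. Qed.

Lemma ler_mean A u v : (forall t, u t <= v t) -> mean A u <= mean A v.
Proof. by move=> uv; rewrite ler_wpM2r ?invr_ge0 // ler_sum. Qed.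

Lemma mean_ext A u v : u =1 v -> mean A u = mean A v.
Proof. by move=> /funext ->. Qed.

(** The variance of [u] over [A] is nonnegative. *)
Lemma sqr_norm_mean A u : A != fset0 ->
  `|mean A u| ^+ 2 <= mean A (fun t => `|u t| ^+ 2).
Proof.
move=> A0; rewrite -subr_ge0; set m := mean A u.
have <- : mean A (fun t => `|u t - m| ^+ 2) =
    mean A (fun t => `|u t| ^+ 2) - `|m| ^+ 2.
  have -> : mean A (fun t => `|u t - m| ^+ 2) = mean A (fun t =>
      `|u t| ^+ 2 + ((- m^*%R) * u t + ((- m) * (u t)^*%R + m * m^*%R))).
    by apply: mean_ext => t; rewrite !normCK rmorphB /=; ring.
  rewrite !meanD !meanZ mean_const // mean_conj -/m normCK; ring.
rewrite divr_ge0 // sumr_ge0 // => t _; exact: exprn_ge0.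
Qed.

(** Only the two differences of [A] and [B] contribute, and each of their
    points contributes at most [1]. *)
Lemma norm_sumB_fset A B u : (forall t, `|u t| <= 1) ->
  `|\sum_(t <- B) u t - \sum_(t <- A) u t| <=
  (#|` B| - #|` (B `&` A)%fset|)%N%:R + (#|` A| - #|` (B `&` A)%fset|)%N%:R.
Proof.
move=> u1.
have split_sum (X Y : {fset rat}) : \sum_(t <- X) u t =
    \sum_(t <- (X `&` Y)%fset) u t + \sum_(t <- (X `\` Y)%fset) u t.
  rewrite (big_fsetID _ (mem Y)) /=; congr (_ + _); apply: eq_fbigl => x;
  by rewrite !inE // andbC.
have bound (X : {fset rat}) : `|\sum_(t <- X) u t| <= #|` X|%:R.
  apply: le_trans (ler_norm_sum _ _ _) _.
  apply: le_trans (ler_sum _ (fun t _ => u1 t)) _.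
  by rewrite big_const_seq count_predT iter_addr_0.
rewrite (split_sum B A) (split_sum A B) (fsetIC A B).
rewrite opprD addrACA subrr add0r.
rewrite -cardfsD -(fsetIC A B) -cardfsD.
apply: le_trans (ler_normB _ _) _; exact: lerD.
Qed.

Variable F : nat -> {fset rat}.
Hypothesis folF : folner_sequence R F.

(** A translate of a Folner set differs from it in a vanishing proportion of
    its points. *)
Lemma mean_translate (x : rat) u : (forall t, `|u t| <= 1) ->
  vanishing (fun N => mean (F N) (fun t => u (x + t)) - mean (F N) u).
Proof.
move=> u1 e e0; have [F0 /(_ x)/cvgrPdist_le/(_ (e / 2))] := folF.
rewrite divr_gt0 // => /(_ isT); apply: filterS => N.
set c := #|` _|; set n := #|` F N|.
have n0 : (0 < n)%N by rewrite cardfs_gt0.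
have cn : (c <= n)%N by rewrite fsubset_leq_card // fsubsetIr.
move=> cne; rewrite /mean -mulrBl normrM normfV normr_nat ler_pdivrMr ?ltr0n //.
have -> : \sum_(t <- F N) u (x + t) = \sum_(t <- translate x (F N)) u t.
  by rewrite big_imfset //= => a b _ _ /addrI.
apply: le_trans (norm_sumB_fset _ _ u1) _.
have -> : #|` translate x (F N)| = n.
  by rewrite card_imfset //=; exact: addrI.
have : (n - c)%:R <= e / 2 * n%:R.
  rewrite -ler_pdivrMr ?ltr0n // natrB //; apply: le_trans cne.
  apply: le_trans (ler_norm _); rewrite mulrBl divff //.
  by rewrite pnatr_eq0 -lt0n.
rewrite -lecR rmorphM !rmorph_nat => ne.
rewrite {1}[e]splitr rmorphD /= mulrDl; exact: lerD.
Qed.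

(** Expanding the square gives all correlations between two of the [H] shifts;
    the [H] diagonal ones are at most [1] and carry the weight [1 / H ^ 2]. *)
Lemma mean_square_average_bound (u : rat -> R[i]) (H N : nat) :
  (forall t, `|u t| <= 1) -> (0 < H)%N ->
  `|mean (F N) (fun t => H%:R^-1 * \sum_(h < H) u (h%:R + t))| ^+ 2 <=
   H%:R^-1 + `|H%:R ^- 2 * \sum_(h < H) \sum_(k < H | k != h)
      mean (F N) (fun t => u (h%:R + t) * (u (k%:R + t))^*%R)|.
Proof.
move=> u1 H0; have F0 := folF.1 N.
have HN0 : H%:R != 0 :> R[i] by rewrite pnatr_eq0 -lt0n.
pose M (h k : 'I_H) := mean (F N) (fun t => u (h%:R + t) * (u (k%:R + t))^*%R).
set E := _ * \sum_(h < H) _.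
have meanE : mean (F N) (fun t => `|H%:R^-1 * \sum_(h < H) u (h%:R + t)| ^+ 2) =
    H%:R ^- 2 * (\sum_(h < H) M h h) + E.
  rewrite /E -mulrDr -big_split /=.
  transitivity (H%:R ^- 2 * \sum_(h < H) \sum_(k < H) M h k); last first.
    by congr (_ * _); apply: eq_bigr => h _; rewrite (bigD1 h).
  rewrite /M; under [in RHS]eq_bigr do rewrite -mean_sum.
  rewrite -mean_sum -meanZ; apply: mean_ext => t.
  rewrite normCK rmorphM fmorphV rmorph_nat mulrACA -expr2 exprVn; congr (_ * _).
  by rewrite rmorph_sum mulr_suml; apply: eq_bigr => h _; rewrite mulr_sumr.
have diag : `|H%:R ^- 2 * (\sum_(h < H) M h h)| <= H%:R^-1.
  rewrite normrM normrV ?unitfE ?expf_neq0 // normrX normr_nat -exprVn expr2.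
  rewrite -mulrA ger_pMr ?invr_gt0 ?ltr0n // ler_pdivrMl ?ltr0n // mulr1.
  apply: le_trans (ler_norm_sum _ _ _) _.
  rewrite -[leRHS](_ : \sum_(h < H) 1 = _); last by rewrite sumr_const card_ord.
  apply: ler_sum => h _.
  have -> : M h h = mean (F N) (fun t => `|u (h%:R + t)| ^+ 2).
    by apply: mean_ext => t; rewrite normCK.
  rewrite ger0_norm; last first.
    by rewrite divr_ge0 // sumr_ge0 // => t _; exact: exprn_ge0.
  rewrite -[leRHS](mean_const 1 F0); apply: ler_mean => t.
  by rewrite exprn_ile1.
apply: le_trans (sqr_norm_mean _ F0) _; rewrite meanE.
set w := (X in X <= _); have w0 : 0 <= w.
  by rewrite /w -meanE divr_ge0 // sumr_ge0 // => t _; exact: exprn_ge0.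
rewrite -(ger0_norm w0); apply: le_trans (ler_normD _ _) _.
by rewrite lerD2r.
Qed.

(** Averaging [u] over the shifts by [0, ..., H - 1] changes its mean by
    a vanishing amount, while the mean square of that average is at most
    [1 / H] up to finitely many vanishing correlations; [H] is arbitrary. *)
Lemma van_der_corput u : (forall t, `|u t| <= 1) ->
  (forall h k : nat, h != k ->
     vanishing (fun N => mean (F N) (fun t => u (h%:R + t) * (u (k%:R + t))^*%R))) ->
  vanishing (fun N => mean (F N) u).
Proof.
move=> u1 corr e e0.
(* the bound [1 / H + off-diagonal] must stay below [(e / 2) ^ 2] *)
pose e2 := (e / 2) ^+ 2 / 2.
have e20 : 0 < e2 by rewrite divr_gt0 // exprn_gt0 // divr_gt0.
have [H H0 HE] : exists2 H : nat, (0 < H)%N & (H%:R^-1 : R) <= e2.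
  exists (Num.truncn e2^-1).+1 => //.
  rewrite invf_ple ?posrE ?ltr0n //; exact/ltW/truncnS_gt.
have HN0 : H%:R != 0 :> R[i] by rewrite pnatr_eq0 -lt0n.
pose A t := H%:R^-1 * \sum_(h < H) u (h%:R + t).
have shift : vanishing (fun N => mean (F N) u - mean (F N) A).
  have -> : (fun N => mean (F N) u - mean (F N) A) = fun N => - H%:R^-1 *
      \sum_(h < H) (mean (F N) (fun t => u (h%:R + t)) - mean (F N) u).
    apply/funext => N; rewrite /A meanZ mean_sum sumrB sumr_const card_ord.
    by rewrite mulNr mulrBr opprB -(mulr_natl (mean (F N) u) H) mulKf.
  by apply/vanishingZ/vanishing_sum => h _; exact: mean_translate.
have off : vanishing (fun N => H%:R ^- 2 * \sum_(h < H) \sum_(k < H | k != h)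
      mean (F N) (fun t => u (h%:R + t) * (u (k%:R + t))^*%R)).
  apply/vanishingZ/vanishing_sum => h _; apply: vanishing_sum => k kh.
  by apply: corr; rewrite eq_sym.
have eh0 : 0 < e / 2 by rewrite divr_gt0.
apply: filterS2 (shift _ eh0) (off _ e20) => N hs ho.
rewrite -[mean _ u](subrK (mean (F N) A)) [e]splitr rmorphD /=.
apply: le_trans (ler_normD _ _) (lerD hs _).
rewrite -(@ler_pXn2r _ 2) ?nnegrE ?normr_ge0 ?ler0c ?(ltW eh0) //.
apply: le_trans (mean_square_average_bound _ u1 H0) _.
rewrite -(rmorphXn (real_complex R)) (_ : (e / 2) ^+ 2 = e2 + e2); last by rewrite -splitr.
rewrite rmorphD /=; apply: lerD ho.
by rewrite -(rmorph_nat (real_complex R)) -fmorphV lecR.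
Qed.

End Mean.

(** * Rational approximation in [Q_p] *)

Section PadicLocal.
Variable p : prime_number.
Local Notation Zp := (padic_int p).
Local Notation q n := ((sval p)%:Z ^+ n).
Implicit Types (z w : Zp) (x y : padic p).

Lemma padic_fraction x :
  exists z w, w != 0 /\ x = padic_of_int z / padic_of_int w.
Proof.
elim/quotW: x => r; exists (frac r).1, (frac r).2; split.
  exact: denom_ratioP.
apply: (canRL (mulfK _)); first by rewrite tofrac_eq0 denom_ratioP.
rewrite /padic_of_int.
rewrite [LHS](_ : _ = FracField.mul (\pi_(FracField.type Zp) r)%qT
  (FracField.tofrac (frac r).2)) // !piE /FracField.mulf /=.
apply/eqmodP; rewrite /= FracField.equivfE !numden_Ratio ?mulr1 ?oner_neq0 ?denom_ratioP //.
by rewrite mulrC.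
Qed.

Lemma prime_exp_gt0 n : 0 < q n.
Proof. by rewrite exprn_gt0 // ltz_nat prime_gt0 //; exact: svalP p. Qed.

Lemma residue_prime_exp n w : residue ((sval p)%:R ^+ n * w) n = 0.
Proof.
rewrite -natrX /= residue_nat.
have -> : ((sval p ^ n)%N%:Z = q n) by rewrite -!natz natrX.
by rewrite modzz mul0r mod0z.
Qed.

(** The quotient by [p ^ n] has the residues of [z] at shifted levels, divided
    by [p ^ n]. *)
Lemma residue0_dvd z n : residue z n = 0 -> exists w, z = (sval p)%:R ^+ n * w.
Proof.
move=> z0.
have qz m : (q n %| residue z (n + m))%Z.
  by apply/dvdz_mod0P; rewrite residue_modS residue_mod.
have qn0 : q n != 0 by rewrite gt_eqF ?prime_exp_gt0.
pose f m := (residue z (n + m) %/ q n)%Z.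
have fE m : f m * q n = residue z (n + m) by rewrite divzK.
have fS m : (f m.+1 = f m %[mod q m])%Z.
  apply/eqP; rewrite eqz_mod_dvd -(dvdz_mul2r qn0).
  rewrite mulrBl !fE -exprD addnS (addnC m) -eqz_mod_dvd; apply/eqP.
  exact: residueS_mod.
exists (padic_limit fS); apply: padic_int_eq => m.
rewrite -natrX /= residue_nat.
have -> : ((sval p ^ n)%N%:Z = q n) by rewrite -!natz natrX.
by rewrite modzMm mulrC fE addnC residue_modS residue_mod.
Qed.

(** A residue prime to [p] is invertible modulo every power of [p], and the
    inverses are coherent because they are unique. *)
Lemma residue1_unit z : residue z 1 != 0 -> z \is a GRing.unit.
Proof.
move=> z1; have pp : prime (sval p) := svalP p.
have cop n : coprimez (residue z n.+1) (q n).
  rewrite coprimezE abszX; apply: coprimeXr; rewrite coprime_sym prime_coprime //.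
  apply: contra z1 => pz; rewrite -(residue_mod z 1) -(residue_modS z 1 n) add1n.
  by apply/eqP/dvdz_mod0P; rewrite dvdzE expr1.
have inv n : exists u : int, (u * residue z n = 1 %[mod q n])%Z.
  have [u [v uv]] := Bezoutz (residue z n.+1) (q n).
  exists u; rewrite -modzMmr -(residueS_mod z n) modzMmr.
  by rewrite -(eqP (cop n)) -uv addrC modzMDl.
pose u n := projT1 (cid (inv n)).
have uP n : (u n * residue z n = 1 %[mod q n])%Z by rewrite /u; case: cid.
have uS n : (u n.+1 = u n %[mod q n])%Z.
  apply/eqP; rewrite eqz_mod_dvd -(@Gauss_dvdzl _ _ (residue z n.+1)).
    rewrite mulrBl -eqz_mod_dvd -modz_expS uP modz_expS; apply/eqP.
    by rewrite -[in RHS]modzMmr residueS_mod modzMmr uP.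
  by rewrite coprimez_sym.
apply/unitrPr; exists (padic_limit uS); rewrite mulrC.
by apply: padic_int_eq => n /=; rewrite modzMml uP.
Qed.

(** The denominator of a fraction is a power of [p] times a unit, the power
    being read off from its first nonzero residue. *)
Lemma padic_denominator x : exists (n : nat) z,
  (sval p)%:R ^+ n * x = padic_of_int z.
Proof.
have [a [b [b0 ->]]] := padic_fraction x.
have [m bm] : exists m, residue b m != 0.
  apply: contrapT => /forallNP h; case/eqP: b0; apply: padic_int_eq => n.
  by rewrite [RHS]mod0z; apply/eqP/negbNE/negP/h.
case: (ex_minnP (ex_intro (fun m => residue b m != 0) m bm)) => {m bm} -[|k] bk mink.
  by move: bk; rewrite -(residue_mod b 0) expr0 modz1.
have [u bu] : exists u, b = (sval p)%:R ^+ k * u.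
  apply: residue0_dvd; apply/eqP/negbNE/negP => /mink; by rewrite ltnn.
have uu : u \is a GRing.unit.
  apply: residue1_unit; apply/eqP => u1.
  have [w uw] := residue0_dvd u1.
  case/eqP: bk; rewrite bu uw mulrA -exprD addn1; exact: residue_prime_exp.
have pk0 : (sval p)%:R ^+ k != 0 :> padic p.
  by rewrite expf_neq0 // natr_padic_eq0 -lt0n prime_gt0 //; exact: svalP p.
exists k, (a * u^-1); rewrite bu /padic_of_int !rmorphM rmorphV // rmorphXn.
by rewrite rmorph_nat invfM mulrCA mulVKf.
Qed.

Lemma padic_integers_residue0 x n z : (sval p)%:R ^+ n * x = padic_of_int z ->
  residue z n = 0 -> padic_integers x.
Proof.
move=> xz /residue0_dvd[w zw]; exists w => //.
have pk0 : (sval p)%:R ^+ n != 0 :> padic p.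
  by rewrite expf_neq0 // natr_padic_eq0 -lt0n prime_gt0 //; exact: svalP p.
by apply: (mulfI pk0); rewrite xz zw /padic_of_int !rmorphM rmorphXn rmorph_nat.
Qed.

Lemma padic_integersB x y :
  padic_integers x -> padic_integers y -> padic_integers (x - y).
Proof. by move=> xi yi; apply/padic_integersD/padic_integersN. Qed.

Lemma ratr_padicN (r : rat) : ratr (- r) = - ratr r :> padic p.
Proof. by rewrite /ratr numqN denqN rmorphN mulNr. Qed.

Lemma residue_int (m : int) n : residue (m%:~R : Zp) n = (m %% q n)%Z.
Proof.
case: m => k; first exact: residue_nat.
by rewrite NegzE rmorphN /= -pmulrn residue_nat modzNm.
Qed.

(** If [p] divided the denominator, reducing [ratr r * denq r = numq r] modulo
    [p] would show that it divides the numerator as well. *)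
Lemma ratr_padic_integers_denq (r : rat) :
  padic_integers (ratr r : padic p) -> ~~ (sval p %| `|denq r|)%N.
Proof.
rewrite /padic_integers /padic_of_int => -[z _ zr]; apply/negP => pd.
have d0 : (denq r)%:~R != 0 :> padic p by rewrite intr_padic_eq0 denq_neq0.
have : padic_of_int (z * (denq r)%:~R) = padic_of_int (numq r)%:~R.
  by rewrite /padic_of_int rmorphM !rmorph_int /= zr /ratr divfK.
move=> /eqP; rewrite tofrac_eq => /eqP /(congr1 (fun w => residue w 1)).
rewrite /= !residue_int expr1 modzMmr => h.
have pn : (sval p %| `|numq r|)%N.
  rewrite -[sval p]/`|(sval p)%:Z|%N -dvdzE; apply/dvdz_mod0P; rewrite -h.
  by apply/dvdz_mod0P; rewrite dvdz_mull // dvdzE.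
have pp : prime (sval p) := svalP p.
move: (dvdn_gcd (sval p) `|numq r| `|denq r|).
by rewrite pn pd (eqP (coprime_num_den r)) Euclid_dvd1.
Qed.

(** If [p ^ n * x] is integral with residue [m] modulo [p ^ n], the rational
    [m / p ^ n] cancels the fractional part of [x], and it is integral at every
    other prime because its denominator is a power of [p]. *)
Lemma principal_part x : exists r : rat, padic_integers (x - ratr r) /\
  forall p' : prime_number, p' != p -> padic_integers (ratr r : padic p').
Proof.
have [n [z xz]] := padic_denominator x; have pp : prime (sval p) := svalP p.
exists ((residue z n)%:~R / (sval p ^ n)%:R); split.
  apply: (@padic_integers_residue0 _ n (z - (residue z n)%:~R)).
    rewrite mulrBr xz /padic_of_int rmorphB rmorph_int; congr (_ - _).
    have pn0 : (sval p ^ n)%:R != 0 :> padic p.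
      by rewrite natr_padic_eq0 expn_eq0 eqn0Ngt prime_gt0.
    rewrite -natrX -[X in X * _ = _](ratr_nat (padic p)) -ratr_padicM mulrCA.
    by rewrite divff ?mulr1 ?ratr_int // pnatr_eq0 expn_eq0 eqn0Ngt prime_gt0.
  by rewrite /= residue_int modzDmr residue_mod subrr mod0z.
move=> p' p'p; rewrite ratr_padicM ratr_int.
apply: padic_integersM; first exact: padic_integers_int.
have -> : ratr (sval p ^ n)%:R^-1 = ((sval p ^ n)%:R : padic p')^-1.
  have pn0 : (sval p ^ n)%:R != 0 :> padic p'.
    by rewrite natr_padic_eq0 expn_eq0 eqn0Ngt prime_gt0.
  apply: (mulfI pn0); rewrite divff // -[X in X * _ = _](ratr_nat (padic p')).
  by rewrite -ratr_padicM divff ?ratr_padic1 // pnatr_eq0 expn_eq0 eqn0Ngt prime_gt0.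
apply: natr_padic_integersV; apply: contra p'p.
by rewrite Euclid_dvdX ?(svalP p') // dvdn_prime2 ?(svalP p') // => /andP[/eqP pe _];
  apply/eqP/val_inj.
Qed.

End PadicLocal.

(** * Integral adeles *)

Section Adelic.
Variable R : realType.
Local Notation A := (adele R).
Local Notation K := (adele_quot R).
Implicit Types (a b : A) (k : K) (x : rat).

Definition integral_adele a := forall p, padic_integers (adele_fin a p).

Lemma integral_adeleD a b :
  integral_adele a -> integral_adele b -> integral_adele (a + b).
Proof. by move=> ai bi p; exact: padic_integersD. Qed.

Lemma integral_adeleN a : integral_adele a -> integral_adele (- a).
Proof. by move=> ai p; exact: padic_integersN. Qed.

Lemma integral_adele_int (m : int) : integral_adele (adele_diag R m%:~R).
Proof. by move=> p /=; rewrite ratr_int; exact: padic_integers_int. Qed.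

Lemma integral_adeleZ (m : int) a :
  integral_adele a -> integral_adele (m%:~R *: a).
Proof.
move=> ai p; apply: padic_integersM => //; exact: integral_adele_int.
Qed.

(** A prime factor of the denominator would be a place where the rational is
    not integral. *)
Lemma integral_adele_rational x : integral_adele (adele_diag R x) ->
  exists m : int, x = m%:~R.
Proof.
move=> xi; suff d1 : `|denq x|%N = 1%N.
  by exists (numq x); rewrite numqE -[denq x]gez0_abs ?denq_ge0 // d1 mulr1.
apply/eqP; rewrite eqn_leq absz_gt0 denq_neq0 andbT leqNgt; apply/negP => d1.
pose p : prime_number := exist (fun n => is_true (prime n)) _ (pdiv_prime d1).
by have /negP := ratr_padic_integers_denq (xi p); apply; exact: pdiv_dvd.
Qed.

Lemma adele_diagD x y : adele_diag R (x + y) = adele_diag R x + adele_diag R y.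
Proof.
by apply: adele_eq => [|p] /=; rewrite ?rmorphD ?ratr_padicD.
Qed.

Lemma adele_diagN x : adele_diag R (- x) = - adele_diag R x.
Proof.
by apply: adele_eq => [|p] /=; rewrite ?rmorphN ?ratr_padicN.
Qed.

Lemma adele_diagZ x y : adele_diag R (x * y) = x *: adele_diag R y.
Proof.
by apply: adele_eq => [|p] /=; rewrite ?rmorphM ?ratr_padicM.
Qed.

Lemma adele_proj_diag x : adele_proj (adele_diag R x) = 0.
Proof.
rewrite (_ : 0 = adele_proj 0); last by rewrite /adele_proj raddf0.
by apply/adele_proj_eq; exists x; rewrite subr0.
Qed.

Lemma adele_projZ x a : x *: adele_proj a = adele_proj (x *: a).
Proof. exact: adele_quot_scaleE. Qed.

(** Subtracting the principal parts at the finitely many bad primes makes an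
    adele integral: the adeles are the sum of [rat] and the integral ones. *)
Lemma adele_integral_part a : exists x, integral_adele (a - adele_diag R x).
Proof.
have /finite_seqP[s sE] := adele_finP a.
have {sE} : forall p, ~ padic_integers (adele_fin a p) -> p \in s.
  by move=> p pa; have : [set` s] p by rewrite -sE.
elim: s a => [|p s IH] a sP.
  by exists 0; rewrite subr0 => p; apply: contrapT => /sP; rewrite in_nil.
have [r [rp rp']] := principal_part (adele_fin a p).
have [|x xi] := IH (a - adele_diag R r).
  move=> p' p'a; have [pp'|pp'] := eqVneq p' p.
    by case: p'a; rewrite pp'.
  have : p' \in p :: s.
    by apply: sP => ap'; apply: p'a; apply: padic_integersB => //; exact: rp'.
  by rewrite in_cons (negbTE pp').
by exists (r + x); rewrite adele_diagD opprD addrA.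
Qed.

(** * Neighbourhoods of an adele *)

Lemma padic_open_dilate p (U : set (padic p)) (y : padic p) : padic_open U ->
  U y -> exists n : nat, forall c, padic_integers c ->
    U (y + ((sval p) ^ n)%N%:R * c).
Proof.
by move=> oU /oU[n nU]; exists n => _ [z _ <-]; rewrite natrX; exact: nU.
Qed.

(** The sets of all [a + b] with [b] in [N * Z_p] at every prime and with small
    real component are a base of neighbourhoods of [a]; the condition at the
    primes is expressed as integrality of [b / N]. *)
Definition lattice_nbhs a (B : set A) := exists (N : nat) (eta : R),
  [/\ (0 < N)%N, 0 < eta & forall b, integral_adele (N%:R^-1 *: b) ->
     `|adele_inf b| < eta -> B (a + b)].

Lemma lattice_nbhsI a B C :
  lattice_nbhs a B -> lattice_nbhs a C -> lattice_nbhs a (B `&` C).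
Proof.
move=> [N [e [N0 e0 NB]]] [M [h [M0 h0 MC]]].
exists (N * M)%N, (Num.min e h); split; rewrite ?muln_gt0 ?N0 ?lt_min ?e0 //.
move=> b bi; rewrite lt_min => /andP[be bh].
have coarser m n : (0 < n)%N -> integral_adele ((m * n)%:R^-1 *: b) ->
    integral_adele (m%:R^-1 *: b).
  move=> n0; rewrite (_ : m%:R^-1 *: b = (n : int)%:~R *: ((m * n)%:R^-1 *: b)).
    exact: integral_adeleZ.
  by rewrite scalerA natrM invfM mulrC -mulrA mulVf ?mulr1 // pnatr_eq0 -lt0n.
split; first by apply: NB => //; exact: coarser bi.
by apply: MC => //; move: bi; rewrite mulnC; exact: coarser.
Qed.

(** The integer [N] is the product of the prime powers that the finitely many
    constrained places require; a multiple of [N] stays integral elsewhere. *)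
Lemma lattice_nbhs_box B a : adele_boxes B -> B a -> lattice_nbhs a B.
Proof.
move=> [V [F [U [oV /finite_seqP[s sF] oU ->]]]] [Va Fa].
have nP p : exists n, F p -> forall c, padic_integers c ->
    U p (adele_fin a p + ((sval p) ^ n)%N%:R * c).
  have [Fp|nFp] := pselect (F p); last by exists 0%N.
  by have [n nU] := padic_open_dilate (oU _ Fp) ((Fa p).1 Fp); exists n.
pose n p := projT1 (cid (nP p)).
have nU p : F p -> forall c, padic_integers c ->
    U p (adele_fin a p + ((sval p) ^ n p)%N%:R * c) by rewrite /n; case: cid.
have [e e0 eV] : exists2 e : R, 0 < e & forall r : R, `|r| < e -> V (adele_inf a + r).
  have /nbhs_ballP[e /= e0 eV] := open_nbhs_nbhs (conj oV Va).
  by exists e => // x xe; apply: eV; rewrite /ball /= opprD addNKr normrN.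
pose N := (\prod_(p <- s) sval p ^ n p)%N.
have N0 : (0 < N)%N.
  by rewrite prodn_gt0 // => p; rewrite expn_gt0 prime_gt0 //; exact: svalP p.
exists N, e; split => // b bi be; split; first exact: eV.
have bE p : adele_fin b p = N%:R * adele_fin (N%:R^-1 *: b) p.
  rewrite /= mulrA -[X in X * _ * _](ratr_nat (padic p)) -ratr_padicM divff.
    by rewrite ratr_padic1 mul1r.
  by rewrite pnatr_eq0 -lt0n.
split=> [Fp|nFp] /=.
  rewrite bE; have ps : p \in s by move: Fp; rewrite sF.
  have NE : N = (sval p ^ n p * \prod_(t <- rem p s) sval t ^ n t)%N.
    by rewrite /N (big_rem p).
  rewrite {1}NE natrM -mulrA; apply: nU => //.
  by apply: padic_integersM; [exact: (padic_integers_int p (Posz _))|exact: bi].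
apply: padic_integersD; first exact: (Fa p).2.
by rewrite bE; apply: padic_integersM; [exact: (padic_integers_int p (Posz _))|exact: bi].
Qed.

Lemma adele_open_lattice_nbhs (B : set A) a : open B -> B a -> lattice_nbhs a B.
Proof.
move=> [D sD <-] [C DC Ca]; have [F sF FC] := sD _ DC.
suff [N [e [N0 e0 NC]]] : lattice_nbhs a C.
  by exists N, e; split=> // b bi be; exists C => //; exact: NC.
have {sD DC} FP E : E \in F -> lattice_nbhs a E.
  move=> EF; apply: lattice_nbhs_box; first by have := sF _ EF; rewrite inE.
  by move: Ca; rewrite -FC; exact.
have seqP (s : seq (set A)) : (forall E, E \in s -> lattice_nbhs a E) ->
    lattice_nbhs a (\bigcap_(E in [set` s]) E).
  elim: s => [|E s IH] sP.
    by exists 1%N, 1; split=> // b _ _ E.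
  rewrite (_ : \bigcap_(_ in _) _ = E `&` \bigcap_(E' in [set` s]) E'); last first.
    apply/seteqP; split=> [x xs|x [xE xs] E' /=].
      split=> [|E' E's]; apply: xs; first by rewrite /= mem_head.
      by rewrite /= in_cons; apply/orP; right.
    by rewrite in_cons => /predU1P[->//|/xs].
  apply: lattice_nbhsI.
    by apply: sP; rewrite mem_head.
  by apply: IH => E' E's; apply: sP; rewrite in_cons E's orbT.
by rewrite -FC; exact: seqP.
Qed.

Lemma adele_quot_open_lattice_nbhs (U : set K) a : open U -> U (adele_proj a) ->
  exists (N : nat) (eta : R),
  [/\ (0 < N)%N, 0 < eta & forall b, integral_adele (N%:R^-1 *: b) ->
     `|adele_inf b| < eta -> U (adele_proj (a + b))].
Proof. by move=> oU Ua; exact: (@adele_open_lattice_nbhs (@adele_proj R @^-1` U) a oU Ua). Qed.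

(** * The standard character of the adelic quotient *)

Lemma adele_quot_integral_rep k : exists a, integral_adele a /\ adele_proj a = k.
Proof.
have [x xi] := adele_integral_part (repr k); exists (repr k - adele_diag R x).
by rewrite -adele_diagN adele_projD adele_proj_diag addr0 adele_proj_repr adele_diagN.
Qed.

Lemma integral_rep_unique a b : integral_adele a -> integral_adele b ->
  adele_proj a = adele_proj b ->
  exists m : int, a = b + adele_diag R m%:~R.
Proof.
move=> ai bi /adele_proj_eq[x abx].
have [|m xm] := @integral_adele_rational x.
  by rewrite -abx; apply: integral_adeleD => //; exact: integral_adeleN.
by exists m; rewrite -xm -abx addrC subrK.
Qed.

(** The real component of an integral representative of [k]; another choice
    changes it by an integer, so only its image under [unit_exp] is
    canonical. *)
Definition adele_angle k : R :=
  adele_inf (projT1 (cid (adele_quot_integral_rep k))).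

Definition adele_char k : R[i] := unit_exp (adele_angle k).

Lemma adele_charE a : integral_adele a ->
  adele_char (adele_proj a) = unit_exp (adele_inf a).
Proof.
move=> ai; rewrite /adele_char /adele_angle; case: cid => b [bi ba] /=.
have [m ->] := integral_rep_unique bi ai ba.
by rewrite /= ratr_int unit_expD unit_exp_int mulr1.
Qed.

Lemma adele_charD k l : adele_char (k + l) = adele_char k * adele_char l.
Proof.
have [a [ai <-]] := adele_quot_integral_rep k.
have [b [bi <-]] := adele_quot_integral_rep l.
by rewrite -adele_projD !adele_charE ?unit_expD //; exact: integral_adeleD.
Qed.

Lemma norm_adele_char k : `|adele_char k| = 1.
Proof. exact: norm_unit_exp. Qed.

Lemma adele_char0 : adele_char 0 = 1.
Proof.
have n0 : adele_char 0 != 0 by exact: unit_exp_neq0.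
by apply: (mulfI n0); rewrite -adele_charD addr0 mulr1.
Qed.

Lemma adele_charN k : adele_char (- k) = (adele_char k)^-1.
Proof.
have n0 : adele_char k != 0 by exact: unit_exp_neq0.
by apply: (mulfI n0); rewrite -adele_charD subrr adele_char0 divff.
Qed.

Lemma adele_char_conj (k : K) : (adele_char k)^*%R = adele_char (- k).
Proof.
have n0 : adele_char k != 0 by exact: unit_exp_neq0.
apply: (mulfI n0); rewrite -adele_charD subrr adele_char0 -normCK norm_adele_char.
by rewrite expr1n.
Qed.

(** If the character is close to [1] at [l / N], the real component of an
    integral representative of [l / N] is close to an integer [m]; subtracting
    [m] and multiplying by [N] gives a small representative of [l]. *)
Lemma adele_quot_char_nbhs (U : set K) k : open U -> U k ->
  exists (N : nat) (delta : R), [/\ (0 < N)%N, 0 < delta & forall l,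
     `|adele_char (N%:R^-1 *: l) - 1| < (delta%:C)%C -> U (k + l)].
Proof.
rewrite -(adele_proj_repr k) => oU /(adele_quot_open_lattice_nbhs oU).
move=> [N [eta [N0 eta0 NU]]]; have NR0 : 0 < N%:R :> R by rewrite ltr0n.
have [d d0 dP] := unit_exp_near1 (divr_gt0 eta0 NR0).
exists N, d; split=> // l; have [c [ci cl]] := adele_quot_integral_rep (N%:R^-1 *: l).
rewrite -cl adele_charE // => /dP[m cm].
pose b := N%:R *: (c - adele_diag R m%:~R).
have Nq0 : N%:R != 0 :> rat by rewrite pnatr_eq0 -lt0n.
have -> : l = adele_proj b.
  rewrite /b -adele_projZ -adele_diagN adele_projD adele_proj_diag addr0 cl.
  by rewrite scalerA divff // scale1r.
rewrite -adele_projD; apply: NU.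
  rewrite /b scalerA mulVf // scale1r; apply: integral_adeleD => //.
  by apply/integral_adeleN/integral_adele_int.
rewrite /= ratr_nat ratr_int normrM normr_nat mulrC -ltr_pdivlMr //.
Qed.

(** * Open arcs of the adelic quotient *)

Definition adele_arc (O : set R) : set K :=
  [set adele_proj a | a in [set a | integral_adele a /\ O (adele_inf a)]].

Lemma open_adele_box (B : set A) : adele_boxes B -> open B.
Proof.
move=> boxB; exists [set B]; last by rewrite bigcup_set1.
by move=> _ ->; exact: (finI_from1 id boxB).
Qed.

(** The preimage in the adeles is the union over the rationals [x] of sets
    obtained from boxes by translation by [x] and dilation by [N]. *)
Lemma open_adele_arc (N : nat) (O : set R) : (0 < N)%N -> open O ->
  open [set k : K | adele_arc O (N%:R^-1 *: k)].
Proof.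
move=> N0 oO; pose B x : set A :=
  [set a | integral_adele (N%:R^-1 *: a - adele_diag R x) /\
           O (adele_inf (N%:R^-1 *: a - adele_diag R x))].
suff : open (@adele_proj R @^-1` [set k : K | adele_arc O (N%:R^-1 *: k)]) by [].
have -> : @adele_proj R @^-1` [set k : K | adele_arc O (N%:R^-1 *: k)] = \bigcup_x B x.
  apply/seteqP; split=> [a [b [bi Ob] ab]|a [x _ [xi Ox]]] /=.
    have /adele_proj_eq[x xE] : adele_proj (N%:R^-1 *: a) = adele_proj b.
      by rewrite -adele_projZ ab.
    by exists x => //; split; rewrite -xE subKr.
  exists (N%:R^-1 *: a - adele_diag R x) => //.
  by rewrite adele_projD -adele_diagN adele_proj_diag addr0 adele_projZ.
apply: bigcup_open => x _; apply: open_adele_box.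
exists [set r | O (ratr N%:R^-1 * r - ratr x)].
exists ([set p | ~ padic_integers (ratr N%:R^-1 : padic p)] `|`
        [set p | ~ padic_integers (ratr x : padic p)]).
exists (fun p => [set y | padic_integers (ratr N%:R^-1 * y - ratr x)]); split.
- apply: open_comp oO => r _; apply: (@continuousB _ R R); last exact: cst_continuous.
  by apply: continuousM; [exact: cst_continuous|].
- by rewrite finite_setU; split; exact: adele_diag_finP.
- move=> p _.
  suff : padic_open [set y : padic p | padic_integers (ratr N%:R^-1 * y - ratr x)] by [].
  move=> y /= yi; have [n [z nz]] := padic_denominator (ratr N%:R^-1 : padic p).
  exists n => z'; rewrite /= mulrDr addrAC mulrA [ratr _ * _ ^+ _]mulrC nz.
  by apply: padic_integersD => //; apply: padic_integersM; [exists z|exists z'].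
- rewrite /B /=; apply/seteqP; split=> a /= [ai Oa]; split=> // p.
    split=> [_|/not_orP[/contrapT Ni /contrapT xi]]; first exact: ai.
    have Nq0 : N%:R != 0 :> rat by rewrite pnatr_eq0 -lt0n.
    rewrite -[adele_fin a p]mul1r -(ratr_padic1 p) -(divff Nq0) ratr_padicM -mulrA.
    apply: padic_integersM; first by rewrite ratr_nat; exact: (padic_integers_int p (Posz _)).
    by rewrite -[_ * _](subrK (ratr x)); apply: padic_integersD => //; exact: ai.
  have [Fp|/not_orP[/contrapT Ni /contrapT xi]] := pselect (
      ~ padic_integers (ratr N%:R^-1 : padic p) \/
      ~ padic_integers (ratr x : padic p)).
    exact: (Oa p).1.
  apply: padic_integersB => //; apply: padic_integersM => //.
  by apply: (Oa p).2 => -[|].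
Qed.

(** * Duality between the rationals and the adelic quotient *)

(** If the character is trivial at [a / N], an integral representative of [a / N]
    may be chosen with real component [0]. *)
Lemma adele_char_annihilator (N : nat) a : (0 < N)%N ->
  adele_char (adele_proj (N%:R^-1 *: a)) = 1 ->
  exists x b, [/\ a = adele_diag R x + b, integral_adele (N%:R^-1 *: b) &
                 adele_inf b = 0].
Proof.
move=> N0; have [c [ci cE]] := adele_quot_integral_rep (adele_proj (N%:R^-1 *: a)).
rewrite -cE adele_charE // => /unit_exp_eq1[m cm].
have /adele_proj_eq[x xE] := cE.
have Nq0 : N%:R != 0 :> rat by rewrite pnatr_eq0 -lt0n.
exists (N%:R * (m%:~R - x)), (N%:R *: (c - adele_diag R m%:~R)); split.
- rewrite adele_diagZ -scalerDr adele_diagD adele_diagN -xE.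
  have -> : adele_diag R m%:~R - (c - N%:R^-1 *: a) +
      (c - adele_diag R m%:~R) = N%:R^-1 *: a.
    by rewrite opprB (addrC (adele_diag R _)) -addrA (addrC (adele_diag R _)) !subrK.
  by rewrite scalerA divff // scale1r.
- rewrite scalerA mulVf // scale1r; apply: integral_adeleD => //.
  exact/integral_adeleN/integral_adele_int.
- by rewrite /= ratr_int cm subrr mulr0.
Qed.

Lemma padic_divisible_eq0 p (y : padic p) :
  (forall n : nat, padic_integers (ratr (sval p ^ n)%N%:R^-1 * y)) -> y = 0.
Proof.
move=> yi; have [z _ zy] := yi 0%N.
have {}zy : padic_of_int z = y by rewrite zy expn0 invr1 ratr_padic1 mul1r.
suff z0 : z = 0 by rewrite -zy z0 /padic_of_int rmorph0.
apply: padic_int_eq => n; rewrite [RHS]mod0z.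
have [w _ wE] := yi n.
suff -> : z = (sval p)%:R ^+ n * w by exact: residue_prime_exp.
apply/eqP; rewrite -tofrac_eq rmorphM rmorphXn rmorph_nat /=; apply/eqP.
have pn0 : (sval p ^ n)%N%:R != 0 :> rat.
  by rewrite pnatr_eq0 expn_eq0 eqn0Ngt prime_gt0 //; exact: svalP p.
rewrite -/(padic_of_int w) wE mulrA -natrX -[X in _ = X * _ * _](ratr_nat (padic p)).
by rewrite -ratr_padicM divff // ratr_padic1 mul1r -zy.
Qed.

(** The rationals are their own annihilator.  If the character were trivial on
    all rational multiples of [a], then modulo a rational [a] would have real
    component [0] and lie in [N * Z_p] for every [p] and every [N]; the rational
    is the same for all [N], since its real component is determined.  Hence [a]
    would be that rational. *)
Lemma adele_char_separates a : (forall x, a <> adele_diag R x) ->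
  exists y : rat, adele_char (adele_proj (y *: a)) != 1.
Proof.
move=> anq; apply: contrapT => /forallNP h.
have {}h y : adele_char (adele_proj (y *: a)) = 1.
  by apply/eqP/negbNE/negP/h.
have [x [b [aE bi b0]]] := @adele_char_annihilator 1 a isT (h _).
suff b00 : b = 0 by apply: (anq x); rewrite aE b00 addr0.
apply: adele_eq => [|p]; first by rewrite b0 /= rmorph0.
rewrite [RHS](_ : _ = 0); last by rewrite /= (ratr_int (padic p) 0).
apply: padic_divisible_eq0 => n.
have N0 : (0 < sval p ^ n)%N by rewrite expn_gt0 prime_gt0 //; exact: svalP p.
have [x' [b' [aE' bi' b0']]] := adele_char_annihilator N0 (h _).
suff bb' : b = b' by rewrite bb'; exact: bi'.
have xb : adele_diag R (x - x') = b' - b.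
  rewrite adele_diagD adele_diagN; apply/eqP; rewrite subr_eq addrAC eq_sym subr_eq.
  by rewrite [b' + _]addrC -aE' -aE.
have : ratr (x - x') = 0 :> R.
  by have /(congr1 (@adele_inf R)) := xb; rewrite /= b0 b0' subrr.
move/eqP; rewrite fmorph_eq0 => /eqP xx; move: xb; rewrite xx => /esym/eqP.
by rewrite subr_eq0 => /eqP.
Qed.
End Adelic.

(** * Exponential sums over polynomials *)

Section PolynomialPhases.
Variable R : realType.
Local Notation A := (adele R).
Local Notation K := (adele_quot R).
Implicit Types (alpha beta : nat -> A) (h t x : rat).

(** Binomial expansion; the binomial coefficients cut the inner sum at
    [i <= j]. *)
Lemma sum_shifted_powers n alpha h t :
  \sum_(j < n) (h + t) ^+ j *: alpha j =
  \sum_(i < n) t ^+ i *: \sum_(j < n) (h ^+ (j - i) *+ 'C(j, i)) *: alpha j.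
Proof.
under [RHS]eq_bigr do rewrite scaler_sumr.
rewrite exchange_big; apply: eq_bigr => j _ /=.
rewrite exprDn scaler_suml.
rewrite (big_ord_widen n (fun i => (h ^+ (j - i) * t ^+ i *+ 'C(j, i)) *: alpha j)) //.
rewrite big_mkcond; apply: eq_bigr => i _; rewrite scalerA mulrnAr [t ^+ i * _]mulrC.
case: ltnP => // ji; by rewrite bin_small // mulr0n scale0r.
Qed.

Variable F : nat -> {fset rat}.
Hypothesis folF : folner_sequence R F.

(** Shifting by [y] multiplies the phase by the constant [c != 1], but changes
    its means by a vanishing amount only. *)
Lemma linear_phase_vanishing (a b : A) : (forall x, b <> adele_diag R x) ->
  vanishing (fun N => mean (F N) (fun t => adele_char (adele_proj (a + t *: b)))).
Proof.
move=> /adele_char_separates[y]; set c := adele_char _ => c1.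
set u := fun t => _.
have c0 : c - 1 != 0 by rewrite subr_eq0.
have u1 t : `|u t| <= 1 by rewrite norm_adele_char.
apply: vanishing_ext (vanishingZ (c - 1)^-1 (mean_translate folF y u1)) => N.
have -> : mean (F N) (fun t => u (y + t)) = mean (F N) (fun t => c * u t).
  apply: mean_ext => t; rewrite /u /c -adele_charD -adele_projD.
  by rewrite scalerDl addrCA.
by rewrite meanZ -[X in _ * (_ - X)]mul1r -mulrBl mulKf.
Qed.

(** The difference of two shifts of the phase has degree lower by one and its
    leading coefficient is [m.+2 * (h - k)] times the old one, hence still not
    rational: van der Corput's inequality feeds the induction. *)
Lemma polynomial_phase_vanishing m alpha :
  (forall x, alpha m.+1 <> adele_diag R x) ->
  vanishing (fun N => mean (F N) (fun t =>
    adele_char (adele_proj (\sum_(j < m.+2) t ^+ j *: alpha j)))).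
Proof.
elim: m alpha => [|m IH] alpha top.
  apply: vanishing_ext (linear_phase_vanishing (alpha 0%N) top) => N.
  by apply: mean_ext => t; rewrite !big_ord_recl big_ord0 addr0 expr0 scale1r.
apply: (van_der_corput folF) => [t|h k hk]; first by rewrite norm_adele_char.
pose beta i := \sum_(j < m.+3) ((h%:R ^+ (j - i) - k%:R ^+ (j - i)) *+ 'C(j, i)) *: alpha j.
have beta_top : beta m.+2 = 0.
  rewrite /beta big1 // => j _; have [jm|jm] := ltnP j m.+2.
    by rewrite bin_small // mulr0n scale0r.
  rewrite (_ : (j - m.+2)%N = 0%N) ?subrr ?mul0rn ?scale0r //.
  by apply/eqP; rewrite subn_eq0 -ltnS.
have beta_lead : beta m.+1 = ((h%:R - k%:R) *+ m.+2) *: alpha m.+2.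
  rewrite /beta big_ord_recr /= big1 ?add0r => [|j _].
    by rewrite subSn // subnn expr1 binSn.
  have [jm|jm] := ltnP j m.+1; first by rewrite bin_small // mulr0n scale0r.
  rewrite (_ : (j - m.+1)%N = 0%N) ?subrr ?mul0rn ?scale0r //.
  by apply/eqP; rewrite subn_eq0 -ltnS.
have c0 : (h%:R - k%:R) *+ m.+2 != 0 :> rat.
  by rewrite mulrn_eq0 /= subr_eq0 eqr_nat.
apply: vanishing_ext (IH beta _) => [N|x bx].
  apply: mean_ext => t; rewrite adele_char_conj -adele_charD.
  rewrite /adele_proj -raddfB /= -/(adele_proj _).
  congr (adele_char (adele_proj _)).
  rewrite !sum_shifted_powers -sumrB big_ord_recr /= -scalerBr -sumrB.
  have betaE i : \sum_(j < m.+3) ((h%:R ^+ (j - i) *+ 'C(j, i)) *: alpha j -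
      (k%:R ^+ (j - i) *+ 'C(j, i)) *: alpha j) = beta i.
    by apply: eq_bigr => j _; rewrite -scalerBl -mulrnBl.
  rewrite betaE beta_top scaler0 addr0; apply: eq_bigr => i _.
  by rewrite -scalerBr -sumrB betaE.
apply: (top (((h%:R - k%:R) *+ m.+2)^-1 * x)).
by rewrite adele_diagZ -bx beta_lead scalerA mulVf // scale1r.
Qed.

(** A rational leading coefficient contributes nothing modulo the rationals, so
    it can be dropped until the leading coefficient is not rational or the
    polynomial is constant. *)
Lemma polynomial_phase_dichotomy m alpha :
  (exists c, forall t, adele_proj (\sum_(j < m.+1) t ^+ j *: alpha j) = c) \/
  vanishing (fun N => mean (F N) (fun t =>
    adele_char (adele_proj (\sum_(j < m.+1) t ^+ j *: alpha j)))).
Proof.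
elim: m => [|m IH].
  left; exists (adele_proj (alpha 0%N)) => t.
  by rewrite big_ord_recl big_ord0 addr0 expr0 scale1r.
have [[x ax]|/forallNP nx] := pselect (exists x, alpha m.+1 = adele_diag R x); last first.
  by right; exact: polynomial_phase_vanishing.
have drop t : adele_proj (\sum_(j < m.+2) t ^+ j *: alpha j) =
    adele_proj (\sum_(j < m.+1) t ^+ j *: alpha j).
  by rewrite big_ord_recr /= adele_projD ax -adele_diagZ adele_proj_diag addr0.
case: IH => [[c cP]|van]; [left|right].
  by exists c => t; rewrite drop.
by apply: vanishing_ext van => N; apply: mean_ext => t; rewrite drop.
Qed.

(** Padding with zero coefficients, so that polynomials of different degrees
    can be added. *)
Lemma polynomial_mapE (g : rat -> K) : polynomial_map g <->
  exists m alpha, forall n, (m <= n)%N -> forall x,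
    g x = adele_proj (\sum_(j < n.+1) x ^+ j *: alpha j).
Proof.
split=> [[m [alpha gE]]|[m [alpha gE]]]; last first.
  by exists m, (fun j => alpha j) => x; exact: gE.
pose a j := if (j < m.+1)%N then alpha (inord j) else 0.
exists m, a => n mn x; rewrite gE; congr adele_proj.
rewrite (eq_bigr (fun j : 'I_m.+1 => x ^+ j *: a j)); last first.
  by move=> j _; rewrite /a ltn_ord inord_val.
rewrite (big_ord_widen n.+1 (fun j => x ^+ j *: a j)) // big_mkcond.
by apply: eq_bigr => j _; rewrite /a; case: (_ < _)%N; rewrite ?scaler0.
Qed.

Lemma polynomial_mapD (f g : rat -> K) : polynomial_map f -> polynomial_map g ->
  polynomial_map (fun x => f x + g x).
Proof.
move=> /polynomial_mapE[m [a fE]] /polynomial_mapE[n [b gE]].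
apply/polynomial_mapE; exists (m + n)%N, (fun j => a j + b j) => l ml x.
rewrite (fE l) ?(gE l) -?adele_projD -?big_split /=.
- by congr adele_proj; apply: eq_bigr => j _; rewrite scalerDr.
- by apply: leq_trans ml; rewrite leq_addl.
- by apply: leq_trans ml; rewrite leq_addr.
Qed.

Lemma polynomial_mapZ (q : rat) (f : rat -> K) : polynomial_map f ->
  polynomial_map (fun x => q *: f x).
Proof.
move=> [m [a fE]]; exists m, (fun j => q *: a j) => x.
rewrite fE adele_projZ scaler_sumr; congr adele_proj.
by apply: eq_bigr => j _; rewrite !scalerA mulrC.
Qed.

Lemma polynomial_map_sum (I : Type) (r : seq I) (f : I -> rat -> K) :
  (forall i, polynomial_map (f i)) ->
  polynomial_map (fun x => \sum_(i <- r) f i x).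
Proof.
move=> fp; elim: r => [|i r IH].
  exists 0%N, (fun=> 0) => x; rewrite big_nil big1 => [|j _]; last exact: scaler0.
  by rewrite /adele_proj raddf0.
under eq_fun do rewrite big_cons; exact: polynomial_mapD.
Qed.

Lemma nonconstant_phase_vanishing (g : rat -> K) : polynomial_map g ->
  ~ (exists c, forall x, g x = c) ->
  vanishing (fun N => mean (F N) (fun t => adele_char (g t))).
Proof.
move=> /polynomial_mapE[m [alpha gE]] nc.
case: (polynomial_phase_dichotomy m alpha) => [[c cP]|].
  by case: nc; exists c => x; rewrite (gE m).
by apply: vanishing_ext => N; apply: mean_ext => t; rewrite (gE m).
Qed.

End PolynomialPhases.

(** * Fejer kernels on a grid of the torus *)

Section Fejer.
Variable R : realType.
Local Open Scope complex_scope.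
Implicit Types z w : R[i].

(** The Fejer kernel as a function on the unit circle. *)
Definition fejer (M : nat) z : R[i] := M%:R^-1 * `|\sum_(l < M) z ^+ l| ^+ 2.

Lemma fejer_ge0 M z : 0 <= fejer M z.
Proof. by rewrite mulr_ge0 ?invr_ge0 ?exprn_ge0. Qed.

Lemma fejerE M z : fejer M z =
  \sum_(p : 'I_M * 'I_M) M%:R^-1 * (z ^+ p.1 * (z ^+ p.2)^*%R).
Proof.
rewrite /fejer normCK rmorph_sum mulr_suml -mulr_sumr; congr (_ * _).
rewrite -(pair_bigA _ (fun l k : 'I_M => z ^+ l * (z ^+ k)^*%R)) /=.
by apply: eq_bigr => l _; rewrite mulr_sumr.
Qed.

(** The geometric sum equals [(z ^ M - 1) / (z - 1)], whose numerator has norm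
    at most [2]. *)
Lemma fejer_away M (delta : R) z : (0 < M)%N -> 0 < delta -> `|z| = 1 ->
  delta%:C <= `|z - 1| -> fejer M z <= (4 / (M%:R * delta ^+ 2))%:C.
Proof.
move=> M0 d0 z1 dz; have dC : 0 < delta%:C by rewrite (ltcR 0).
have n0 : 0 < `|z - 1| by exact: lt_le_trans dz.
have -> : (4 / (M%:R * delta ^+ 2))%:C = M%:R^-1 * (2 / delta%:C) ^+ 2.
  rewrite !rmorphM fmorphV rmorphM rmorphXn !rmorph_nat; field.
  by rewrite pnatr_eq0 -lt0n M0 gt_eqF.
rewrite ler_wpM2l ?invr_ge0 //.
rewrite ler_pXn2r ?nnegrE ?normr_ge0 ?divr_ge0 ?(ltW dC) //.
rewrite ler_pdivlMr //; apply: le_trans (ler_wpM2l _ dz) _ => //.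
rewrite -normrM mulrC -subrX1; apply: le_trans (ler_normB _ _) _.
by rewrite normrX z1 expr1n normr1.
Qed.

Lemma sum_unit_exp_roots M (k : int) : (0 < M)%N -> (`|k| < M)%N ->
  \sum_(i < M) unit_exp (k%:~R / M%:R : R) ^+ i = (k == 0)%:R * M%:R.
Proof.
move=> M0 kM; have MR : M%:R != 0 :> R by rewrite pnatr_eq0 -lt0n.
have [->|k0] := eqVneq k 0.
  rewrite mul0r mul1r unit_exp0; under eq_bigr do rewrite expr1n.
  by rewrite sumr_const card_ord.
set z := unit_exp _; rewrite mul0r.
have z1 : z - 1 != 0.
  rewrite subr_eq0; apply/eqP => /unit_exp_eq1[m /(canRL (divfK MR))].
  rewrite -(intrM _ m M%:Z) => /intr_inj kE; move: kM k0; rewrite kE abszM /=.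
  by case: (m) => -[|n]; rewrite ?mul0r // mulSn ltnNge leq_addr.
apply: (mulfI z1); rewrite -subrX1 mulr0 -unit_expMn.
by rewrite -[_ *+ M]mulr_natr divfK // unit_exp_int subrr.
Qed.

Definition grid_root M (i : 'I_M) : R[i] := unit_exp (- (i%:R / M%:R)).

Lemma norm_grid_root M (i : 'I_M) : `|grid_root i| = 1.
Proof. exact: norm_unit_exp. Qed.

(** The kernel only involves the powers of [z] with exponents strictly between
    [- M] and [M]; the [M]-point grid integrates these exactly, so the sum is
    [M] times the constant term. *)
Lemma fejer_grid_sum M z : (0 < M)%N -> `|z| = 1 ->
  \sum_(i < M) fejer M (z * grid_root i) = M%:R.
Proof.
move=> M0 z1; under eq_bigr do rewrite fejerE.
rewrite exchange_big /=.
have conjz : z * z^*%R = 1 by rewrite -normCK z1 expr1n.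
have rootE (l k i : 'I_M) : grid_root i ^+ l * (grid_root i ^+ k)^*%R =
    unit_exp ((k%:Z - l%:Z)%:~R / M%:R) ^+ i.
  have conjE : (grid_root i)^*%R = unit_exp (i%:R / M%:R).
    apply: (mulfI (unit_exp_neq0 (- (i%:R / M%:R)))).
    by rewrite -unit_expD addNr unit_exp0 /grid_root -normCK norm_unit_exp expr1n.
  rewrite rmorphXn /= conjE /grid_root -!unit_expMn -unit_expD; congr unit_exp.
  by rewrite intrB -!pmulrn; ring.
have term (p : 'I_M * 'I_M) : \sum_(i < M) M%:R^-1 *
    ((z * grid_root i) ^+ p.1 * ((z * grid_root i) ^+ p.2)^*%R) = (p.1 == p.2)%:R.
  transitivity (M%:R^-1 * (z ^+ p.1 * (z ^+ p.2)^*%R) *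
      \sum_(i < M) unit_exp ((p.2%:Z - p.1%:Z)%:~R / M%:R) ^+ i).
    rewrite mulr_sumr; apply: eq_bigr => i _.
    by rewrite -rootE !exprMn rmorphM -[RHS]mulrA; congr (_ * _); exact: mulrACA.
  rewrite sum_unit_exp_roots //; last first.
    by case: p => l k /=; have := ltn_ord l; have := ltn_ord k; lia.
  rewrite subr_eq0 (_ : (_ == _) = (p.1 == p.2)); last by rewrite eqz_nat eq_sym.
  have [->|] := eqVneq p.1 p.2; last first.
    by rewrite mul0r mulr0.
  rewrite rmorphXn /= -exprMn conjz expr1n mul1r mulr1 mulVf //.
  by rewrite pnatr_eq0 -lt0n.
under eq_bigr do rewrite term.
rewrite -(pair_bigA _ (fun l k : 'I_M => (l == k)%:R)) /=.
under eq_bigr => l _.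
  rewrite (bigD1 l) //= eqxx big1 ?addr0; last first.
    by move=> k /negbTE; rewrite eq_sym => ->.
  over.
by rewrite sumr_const card_ord.
Qed.

Variables (d M : nat).
Hypothesis M0 : (0 < M)%N.
Implicit Types (I : pred {ffun 'I_d -> 'I_M}) (v : 'I_d -> R[i]).

(** Convolution of a product of Fejer kernels with the uniform measure on the
    grid points of [I]: a trigonometric polynomial close to the indicator of
    the union of small balls around these points. *)
Definition grid_kernel I v : R[i] := (M ^ d)%N%:R^-1 *
  \sum_(i : {ffun 'I_d -> 'I_M} | I i) \prod_j fejer M (v j * grid_root (i j)).

Lemma grid_kernel_le1 I v : (forall j, `|v j| = 1) -> grid_kernel I v <= 1.
Proof.
move=> v1; have Md0 : 0 < (M ^ d)%N%:R :> R[i] by rewrite ltr0n expn_gt0 M0.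
rewrite /grid_kernel ler_pdivrMl // mulr1.
apply: (@le_trans _ _ (\sum_(i : {ffun 'I_d -> 'I_M})
    \prod_j fejer M (v j * grid_root (i j)))).
  rewrite big_mkcond; apply: ler_sum => i _; case: ifP => // _.
  by apply: prodr_ge0 => j _; exact: fejer_ge0.
rewrite -(bigA_distr_bigA (fun j a => fejer M (v j * grid_root a))) /=.
under eq_bigr do rewrite fejer_grid_sum //.
by rewrite prodr_const card_ord natrX.
Qed.

(** Summing over the whole grid makes every factor but one equal to [M];
    the remaining factor is small at each point of [I]. *)
Lemma grid_kernel_away I v (delta : R) : 0 < delta -> (forall j, `|v j| = 1) ->
  (forall i, I i -> exists j, delta%:C <= `|v j * grid_root (i j) - 1|) ->
  grid_kernel I v <= (d%:R * (4 / (M%:R * delta ^+ 2)))%:C.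
Proof.
move=> d0 v1 away; set c := 4 / _.
have Md0 : 0 < (M ^ d)%N%:R :> R[i] by rewrite ltr0n expn_gt0 M0.
have c0 : 0 <= c%:C.
  by rewrite ler0c divr_ge0 // mulr_ge0 // exprn_ge0 // ltW.
pose f (j0 j : 'I_d) (a : 'I_M) := if j == j0 then 1 else fejer M (v j * grid_root a).
have f0 j0 j a : 0 <= f j0 j a by rewrite /f; case: ifP; rewrite ?fejer_ge0.
have fprod (i : {ffun 'I_d -> 'I_M}) : I i ->
    \prod_j fejer M (v j * grid_root (i j)) <= \sum_j0 c%:C * \prod_j f j0 j (i j).
  move=> /away[j0 j0P].
  rewrite [leRHS](bigD1 j0) //= -[leLHS]addr0; apply: lerD; last first.
    by apply: sumr_ge0 => j _; rewrite mulr_ge0 // prodr_ge0.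
  rewrite (bigD1 j0) //= [X in _ <= _ * X](bigD1 j0) //= {1}/f eqxx mul1r.
  rewrite (eq_bigr (fun j => f j0 j (i j))); last by move=> j /negbTE; rewrite /f => ->.
  apply: ler_wpM2r; first by rewrite prodr_ge0.
  by apply: fejer_away => //; rewrite normrM v1 norm_grid_root mulr1.
rewrite /grid_kernel ler_pdivrMl //.
apply: (@le_trans _ _ (\sum_(i : {ffun 'I_d -> 'I_M}) \sum_j0 c%:C * \prod_j f j0 j (i j))).
  rewrite big_mkcond; apply: ler_sum => i _; case: ifP => [/fprod//|_].
  by apply: sumr_ge0 => j _; rewrite mulr_ge0 // prodr_ge0.
rewrite exchange_big /=.
have colsum j0 : \sum_(i : {ffun 'I_d -> 'I_M}) c%:C * \prod_j f j0 j (i j) =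
    c%:C * (M ^ d)%N%:R.
  rewrite -mulr_sumr -(bigA_distr_bigA (fun j a => f j0 j a)) /=; congr (_ * _).
  transitivity (\prod_(j < d) (M%:R : R[i])); last first.
    by rewrite prodr_const card_ord natrX.
  apply: eq_bigr => j _; rewrite /f.
  case: (j == j0); first by rewrite sumr_const card_ord.
  exact: fejer_grid_sum.
under eq_bigr do rewrite colsum.
rewrite sumr_const card_ord (rmorphM _ d%:R c) rmorph_nat -[leLHS]mulr_natl.
by rewrite [leRHS]mulrC -mulrA.
Qed.

End Fejer.

(** * Means of the grid kernel *)

Section WeylGrid.
Variable R : realType.
Local Notation K := (adele_quot R).
Local Open Scope complex_scope.

Lemma adele_char_sum (I : Type) (r : seq I) (f : I -> K) :
  adele_char (\sum_(i <- r) f i) = \prod_(i <- r) adele_char (f i).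
Proof. by apply: big_morph; [exact: adele_charD|exact: adele_char0]. Qed.

Lemma adele_charMn (k : K) n : adele_char k ^+ n = adele_char (k *+ n).
Proof.
elim: n => [|n IH]; first by rewrite mulr0n adele_char0.
by rewrite exprS IH mulrS adele_charD.
Qed.

Lemma adele_char_monomial (k : K) (N l m : nat) :
  adele_char (N%:R^-1 *: k) ^+ l * (adele_char (N%:R^-1 *: k) ^+ m)^*%R =
  adele_char (((l%:R - m%:R) / N%:R) *: k).
Proof.
rewrite !adele_charMn adele_char_conj -adele_charD; congr adele_char.
by rewrite -!scaler_nat !scalerA -scalerBl -mulrBl.
Qed.

Variable F : nat -> {fset rat}.
Hypothesis folF : folner_sequence R F.
Variables (d : nat) (v : rat -> 'rV[K]_d).
Hypothesis weylv : forall n : 'rV[rat]_d, n != 0 ->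
  vanishing (fun N => mean (F N) (fun t => adele_char (\sum_j n 0 j *: v t 0 j))).
Variables (N M : nat).
Hypotheses (N0 : (0 < N)%N) (M0 : (0 < M)%N).

Definition torus_point (k : 'rV[K]_d) (j : 'I_d) : R[i] :=
  adele_char (N%:R^-1 *: k 0 j).

(** Each kernel expands into characters.  The nontrivial ones have vanishing
    mean, and the constant terms of the kernel centred at one grid point add up
    to [1]. *)
Lemma grid_kernel_mean (I : pred {ffun 'I_d -> 'I_M}) :
  vanishing (fun n => mean (F n) (fun t => grid_kernel I (torus_point (v t))) -
                      (M ^ d)%N%:R^-1 * #|I|%:R).
Proof.
pose term (i : {ffun 'I_d -> 'I_M}) (p : {ffun 'I_d -> 'I_M * 'I_M}) t : R[i] :=
  \prod_j (M%:R^-1 * ((torus_point (v t) j * grid_root R (i j)) ^+ (p j).1 *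
             ((torus_point (v t) j * grid_root R (i j)) ^+ (p j).2)^*%R)).
pose diag (p : {ffun 'I_d -> 'I_M * 'I_M}) : R[i] :=
  \prod_j (M%:R^-1 * ((p j).1 == (p j).2)%:R).
have kernelE t : grid_kernel I (torus_point (v t)) =
    (M ^ d)%N%:R^-1 * \sum_(i | I i) \sum_p term i p t.
  congr (_ * _); apply: eq_bigr => i _.
  under eq_bigr do rewrite fejerE.
  by rewrite bigA_distr_bigA.
have sum_diag : \sum_p diag p = 1.
  rewrite /diag -(bigA_distr_bigA (fun j (q : 'I_M * 'I_M) =>
    M%:R^-1 * (q.1 == q.2)%:R)) /= big1 // => j _.
  rewrite -mulr_sumr -(pair_bigA _ (fun l k : 'I_M => (l == k)%:R)) /=.
  rewrite (eq_bigr (fun=> 1)); last first.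
    move=> l _; rewrite (bigD1 l) //= eqxx big1 ?addr0 // => k /negbTE.
    by rewrite eq_sym => ->.
  by rewrite sumr_const card_ord mulVf // pnatr_eq0 -lt0n.
suff termV i p : vanishing (fun n => mean (F n) (term i p) - diag p).
  have S : vanishing (fun n => \sum_(i | I i) \sum_p (mean (F n) (term i p) - diag p)).
    by apply: vanishing_sum => i _; apply: vanishing_sum => p _; exact: termV.
  apply: vanishing_ext (vanishingZ (M ^ d)%N%:R^-1 S) => n.
  under [mean _ _]mean_ext do rewrite kernelE.
  rewrite meanZ mean_sum -mulrBr; congr (_ * _).
  under [in RHS]eq_bigr do rewrite sumrB sum_diag -mean_sum.
  by rewrite sumrB sumr_const.
pose n : 'rV[rat]_d := \row_j (((p j).1%:R - (p j).2%:R) / N%:R).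
pose c : R[i] := \prod_j (M%:R^-1 *
  (grid_root R (i j) ^+ (p j).1 * (grid_root R (i j) ^+ (p j).2)^*%R)).
have termE t : term i p t = c * adele_char (\sum_j n 0 j *: v t 0 j).
  rewrite adele_char_sum -big_split /=; apply: eq_bigr => j _.
  rewrite mxE -adele_char_monomial -mulrA; congr (_ * _).
  by rewrite !exprMn rmorphM mulrACA mulrC.
have [n0|n0] := eqVneq n 0; last first.
  have -> : diag p = 0.
    have [j pj] : exists j, (p j).1 != (p j).2.
      apply: contrapT => /forallNP pj; case/eqP: n0; apply/rowP => j.
      by rewrite !mxE; have /negP/negPn/eqP-> := pj j; rewrite subrr mul0r.
    by rewrite /diag (bigD1 j) //= (negbTE pj) mulr0 mul0r.
  apply: vanishing_ext (vanishingZ c (weylv n0)) => k.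
  by rewrite subr0 -meanZ; apply: mean_ext.
have pE j : (p j).1 = (p j).2.
  have := congr1 (fun w : 'rV[rat]_d => w 0 j) n0; rewrite !mxE => /eqP.
  rewrite mulf_eq0 invr_eq0 pnatr_eq0 -[N == _]negbK -lt0n N0 orbF.
  by rewrite subr_eq0 eqr_nat => /eqP /val_inj.
have -> : diag p = c.
  apply: eq_bigr => j _; rewrite -pE eqxx; congr (_ * _).
  by rewrite -normCK normrX norm_grid_root !expr1n.
apply: (vanishing_ext _ (@vanishing0 R)) => k; apply/eqP; rewrite subr_eq0; apply/eqP.
rewrite -[RHS](mean_const c (folF.1 k)); apply: mean_ext => t.
rewrite termE n0 big1 ?adele_char0 ?mulr1 // => j _.
by rewrite mxE scale0r.
Qed.

End WeylGrid.

(** * Frequencies of visits *)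

Section FrequencyBound.
Variable R : realType.
Local Notation K := (adele_quot R).
Local Open Scope complex_scope.
Variable F : nat -> {fset rat}.
Hypothesis folF : folner_sequence R F.
Variables (d : nat) (v : rat -> 'rV[K]_d).
Hypothesis weylv : forall n : 'rV[rat]_d, n != 0 ->
  vanishing (fun N => mean (F N) (fun t => adele_char (\sum_j n 0 j *: v t 0 j))).

Definition frequency (A : {fset rat}) (U : set 'rV[K]_d) : R :=
  #|` [fset t in A | v t \in U]%fset|%:R / #|` A|%:R.

Lemma mean_indicator A U :
  mean A (fun t => (v t \in U)%:R) = (frequency A U)%:C.
Proof.
rewrite /mean /frequency rmorphM fmorphV !rmorph_nat; congr (_ / _).
rewrite card_fset_sum1 natr_sum big_fset /= [RHS]big_mkcond.
by apply: eq_bigr => t _; case: (_ \in _).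
Qed.

(** The grid kernel is at most [1] everywhere and at most the error term
    outside [U], because a point outside [U] is far from all points of [I] in
    some coordinate.  So the indicator of [U] dominates the kernel minus the
    error term. *)
Lemma frequency_lower_bound (N M : nat) (delta : R) (U : set 'rV[K]_d)
    (I : pred {ffun 'I_d -> 'I_M}) (e : R) :
  (0 < N)%N -> (0 < M)%N -> 0 < delta -> 0 < e ->
  (forall i k, I i ->
    (forall j, `|torus_point N k j * grid_root R (i j) - 1| < delta%:C) -> U k) ->
  \forall n \near \oo, #|I|%:R / (M ^ d)%N%:R -
     d%:R * (4 / (M%:R * delta ^+ 2)) - e <= frequency (F n) U.
Proof.
move=> N0 M0 d0 e0 IU; set c := d%:R * _.
have c0 : 0 <= c by rewrite mulr_ge0 // divr_ge0 // mulr_ge0 // exprn_ge0 // ltW.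
have unit_tp k j : `|torus_point N k j| = 1 by exact: norm_adele_char.
have dominated k : grid_kernel I (torus_point N k) + (- c)%:C <= (k \in U)%:R.
  have [kU|kU] := boolP (k \in U).
    rewrite -[leRHS]addr0; apply: lerD; first exact: grid_kernel_le1.
    by rewrite lecR oppr_le0.
  rewrite rmorphN /= subr_le0; apply: grid_kernel_away => // i Ii.
  apply: contrapT => /forallNP away; move/negP: kU; apply; rewrite inE.
  apply: (IU i) => // j; rewrite real_ltNge ?normr_real //; first exact/negP/away.
  by rewrite complex_real.
apply: filterS (grid_kernel_mean folF weylv N0 M0 I e0) => n.
set m := mean _ _ => me.
have mR : m \is Num.real.
  apply/ger0_real/divr_ge0 => //; apply: sumr_ge0 => t _.
  rewrite mulr_ge0 ?invr_ge0 //; apply: sumr_ge0 => i _.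
  by apply: prodr_ge0 => j _; exact: fejer_ge0.
rewrite -lecR -mean_indicator.
apply: le_trans (ler_mean _ (fun t => dominated (v t))).
rewrite meanD mean_const ?(folF.1 n) // -/m addrAC !rmorphD /= !rmorphN /= lerD2r.
rewrite lerBlDr -lerBlDl rmorphM fmorphV !rmorph_nat [X in X - _]mulrC.
apply: le_trans me; rewrite distrC; apply: real_ler_norm.
by rewrite realB // realM ?realV ?realn.
Qed.

End FrequencyBound.

(** * Cells of the grid and their measure *)

Section Cells.
Variables (R : realType) (d : nat).
Local Notation K := (adele_quot R).
Local Notation Kd := ('rV[K]_d).
Local Notation BKd := (g_sigma_algebraType (@open Kd)).
Local Open Scope complex_scope.

Lemma real_adele_finP :
  finite_set [set p : prime_number | ~ padic_integers (0 : padic p)].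
Proof.
apply: (@sub_finite_set _ _ set0) => // p /=; apply.
exact: (padic_integers_int p 0).
Qed.

Definition real_adele (r : R) : adele R := Adele r real_adele_finP.

Lemma integral_real_adele r : integral_adele (real_adele r).
Proof. by move=> p; exact: (padic_integers_int p 0). Qed.

Variables (N M : nat).
Hypotheses (N0 : (0 < N)%N) (M1 : (1 < M)%N).
Implicit Types (i : {ffun 'I_d -> 'I_M}) (k : Kd).

Let NR0 : N%:R != 0 :> rat. Proof. by rewrite pnatr_eq0 -lt0n. Qed.
Let MR0 : 0 < M%:R :> R. Proof. by rewrite ltr0n ltnW. Qed.

(** The half-open cube of side [1 / M] with corner [x / M] in the coordinates
    [k j / N] of the torus. *)
Definition cube (x : 'I_d -> nat) : set Kd :=
  [set k | forall j, adele_arc [set r | (x j)%:R / M%:R <= r < (x j).+1%:R / M%:R]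
                               (N%:R^-1 *: k 0 j)].

Definition cell i : set Kd := cube (fun j => i j).

(** The grid point of index [i], as a point of [K^d] with zero [p]-adic
    components. *)
Definition cell_corner i : Kd :=
  \row_j adele_proj (N%:R *: real_adele ((i j)%:R / M%:R)).

Lemma cell_translate i : [set cell_corner i + k | k in cube (fun=> 0%N)] = cell i.
Proof.
have cornerE j : N%:R^-1 *: cell_corner i 0 j = adele_proj (real_adele ((i j)%:R / M%:R)).
  by rewrite mxE adele_projZ scalerA mulVf // scale1r.
apply/seteqP; split=> [_ [k ck <-] j|k ck].
  have [a [/= ai /andP[a0 a1]] ak] := ck j.
  exists (real_adele ((i j)%:R / M%:R) + a); last first.
    by rewrite mxE scalerDr -ak cornerE adele_projD.
  split; first by apply: integral_adeleD => //; exact: integral_real_adele.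
  rewrite /= -natr1 mulrDl; move: a0 a1; rewrite mul0r => a0 a1.
  by rewrite lerDl a0 ltrD2l.
exists (k - cell_corner i); last by rewrite addrC subrK.
move=> j; have [a [/= ai /andP[a0 a1]] ak] := ck j.
exists (a - real_adele ((i j)%:R / M%:R)).
  split; first by apply/integral_adeleD/integral_adeleN/integral_real_adele.
  rewrite /= mul0r subr_ge0 a0 /= ltrBlDl -mulrDl natr1; exact: a1.
have -> : (k - cell_corner i) 0 j = k 0 j - cell_corner i 0 j by rewrite !mxE.
rewrite scalerBr -ak cornerE.
by rewrite /adele_proj raddfB.
Qed.

(** Integral representatives of the same point with real components in [[0, 1[
    have the same real component. *)
Lemma cell_trivIset (D : set {ffun 'I_d -> 'I_M}) : trivIset D cell.
Proof.
move=> i i' _ _ [k [ci ci']]; apply/ffunP => j; apply/val_inj/eqP.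
have [a [/= ai /andP[a0 a1]] ak] := ci j; have [b [/= bi /andP[b0 b1]] bk] := ci' j.
have ab : adele_inf a = adele_inf b.
  have [m aE] := integral_rep_unique ai bi (etrans ak (esym bk)).
  have aE' : adele_inf a = adele_inf b + m%:~R by rewrite aE /= ratr_int.
  have in01 (l : 'I_M) (r : R) : l%:R / M%:R <= r -> r < l.+1%:R / M%:R -> 0 <= r < 1.
    move=> lr rl; rewrite (le_trans _ lr) ?divr_ge0 //= (lt_le_trans rl) //.
    by rewrite ler_pdivrMr // mul1r ler_nat.
  have /andP[A0 A1] := in01 _ _ a0 a1; have /andP[B0 B1] := in01 _ _ b0 b1.
  have m1 : m%:~R < 1%:~R :> R by move: aE' => /=; lra.
  have m2 : (-1)%:~R < m%:~R :> R by move: aE'; rewrite mulrN1z; lra.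
  rewrite aE'; move: m1 m2; rewrite !ltr_int => m1 m2.
  by rewrite (_ : m = 0) ?addr0 //; lia.
have order (l l' : 'I_M) (r : R) : l%:R / M%:R <= r -> r < l'.+1%:R / M%:R -> (l <= l')%N.
  move=> lr rl'; have := le_lt_trans lr rl'.
  by rewrite ltr_pM2r ?invr_gt0 // ltr_nat ltnS.
by rewrite eqn_leq (order _ _ _ a0) ?ab // (order _ _ _ b0) // -ab.
Qed.

Lemma cell_cover k : exists i, cell i k.
Proof.
have ex j : exists l : 'I_M,
    adele_arc [set r | l%:R / M%:R <= r < l.+1%:R / M%:R] (N%:R^-1 *: k 0 j).
  have [a [ai ak]] := adele_quot_integral_rep (N%:R^-1 *: k 0 j).
  pose m := Num.floor (adele_inf a); pose r := adele_inf a - m%:~R.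
  have /andP[m1 m2] := floor_itv (adele_inf a).
  have r0 : 0 <= r by rewrite subr_ge0.
  have r1 : r < 1 by rewrite /r ltrBlDl; move: m2; rewrite intrD addrC.
  have rM0 : 0 <= r * M%:R by rewrite mulr_ge0.
  have /andP[t0 t1] := truncn_itv rM0.
  have tM : (Num.truncn (r * M%:R)%R < M)%N.
    by rewrite -(ltr_nat R) (le_lt_trans t0) // gtr_pMl.
  exists (Ordinal tM), (a - adele_diag R m%:~R).
    split; first by apply/integral_adeleD/integral_adeleN/integral_adele_int.
    by rewrite /= ratr_int -/r ler_pdivrMr // t0 ltr_pdivlMr.
  by rewrite -adele_diagN adele_projD adele_proj_diag addr0.
pose f j := projT1 (cid (ex j)).
by exists (finfun f) => j; rewrite ffunE /f; case: cid.
Qed.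

Lemma open_coordinate (j : 'I_d) (U : set K) : open U -> open [set k : Kd | U (k 0 j)].
Proof.
move=> oU; rewrite openE => k /= Uk.
exists (fun _ j' => [set l | j' = j -> U l]) => [i j'|k' k'U]; last first.
  exact: (k'U 0 j).
have [->|jj'] := eqVneq j' j; last first.
  by apply: filterE => l /eqP; rewrite (negbTE jj').
rewrite (ord1 i); apply: filterS (open_nbhs_nbhs (conj oU Uk)) => l Ul _ //.
Qed.

Lemma measurable_open (U : set Kd) : open U -> measurable (U : set BKd).
Proof. exact: sub_sigma_algebra. Qed.

(** A half-open arc of length at most [1 / 2] is the difference of two open
    arcs of length at most [1], which do not wrap around the circle. *)
Lemma measurable_cube (x : 'I_d -> nat) : measurable (cube x : set BKd).
Proof.
pose u j : R := (x j)%:R / M%:R.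
pose big j : set R := `](u j - 2^-1), (u j + M%:R^-1)[%classic.
pose small j : set R := `](u j - 2^-1), (u j)[%classic.
pose pull (O : set R) j := [set k : Kd | adele_arc O (N%:R^-1 *: k 0 j)].
have openP (O : set R) j : open O -> open (pull O j).
  by move=> oO; exact: (open_coordinate (open_adele_arc N0 oO)).
have M2 : M%:R^-1 <= 2^-1 :> R.
  by rewrite lef_pV2 ?posrE // ?ltr0n // ler_nat.
have uS j : (x j).+1%:R / M%:R = u j + M%:R^-1 :> R by rewrite -natr1 mulrDl mul1r.
have -> : cube x = \bigcap_(j in [set: 'I_d]) (pull (big j) j `\` pull (small j) j).
  apply/seteqP; split=> k kc.
    move=> j _; have [a [/= ai]] := kc j; rewrite uS -/(u j) => /andP[a0 a1] ak.
    split; first by exists a => //; split => //; rewrite /big /= in_itv /= a1 andbT; lra.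
    move=> [b [bi]]; rewrite /small /= in_itv /= => /andP[b0 b1] bk.
    have [m aE] := integral_rep_unique ai bi (etrans ak (esym bk)).
    have aE' : adele_inf a = adele_inf b + m%:~R by rewrite aE /= ratr_int.
    have m1 : m%:~R < 1%:~R :> R by move: aE' => /=; lra.
    have m2 : 0%:~R < m%:~R :> R by rewrite mulr0z; move: aE'; lra.
    by move: m1 m2; rewrite !ltr_int; lia.
  move=> j; have [[a [ai]]] := kc j I; rewrite /big /= in_itv /= => /andP[a0 a1] ak ns.
  exists a => //; split=> //=; rewrite uS a1 andbT leNgt; apply/negP => aneg.
  by apply: ns; exists a => //; split=> //; rewrite /small /= in_itv /= a0.
apply: fin_bigcap_measurable => // j _; apply: measurableD; apply: measurable_open;
  by apply: openP; exact: itv_open.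
Qed.

Variable mu : probability BKd R.
Hypothesis haar : normalized_haar mu.


(** The [M ^ d] cells are disjoint translates of one of them, so that each has
    measure at most [1 / M ^ d]. *)
Lemma mu_cells (I : pred {ffun 'I_d -> 'I_M}) :
  (mu (\bigcup_(i in [set` I]) cell i) <= (#|I|%:R / (M ^ d)%N%:R)%:E)%E.
Proof.
set c := mu (cube (fun=> 0%N) : set BKd).
have cellE i : mu (cell i : set BKd) = c by rewrite -cell_translate haar //; exact: measurable_cube.
have [c' cE] : exists c', c = c'%:E.
  exists (fine c); rewrite fineK //; apply: fin_num_measure; exact: measurable_cube.
have sumE (J : pred {ffun 'I_d -> 'I_M}) :
    mu (\bigcup_(i in [set` enum J]) cell i : set BKd) = (c' *+ #|J|)%:E.
  rewrite measure_fin_bigcup //; last 2 first.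
  - exact: cell_trivIset.
  - by move=> i _; exact: measurable_cube.
  rewrite -fsbig_seq ?enum_uniq //=.
  under eq_bigr do rewrite cellE cE.
  by rewrite sumEFin big_const_seq count_predT -cardE iter_addr_0.
have -> : [set` I] = [set` enum I] by apply/seteqP; split=> i /=; rewrite mem_enum.
rewrite sumE lee_fin ler_pdivlMr ?ltr0n ?expn_gt0 ?(ltnW M1) //.
have : ((c' *+ #|{: {ffun 'I_d -> 'I_M}}|)%:E <= 1)%E.
  rewrite -sumE; apply: probability_le1; apply: fin_bigcup_measurable => // i _.
  exact: measurable_cube.
rewrite lee_fin card_ffun !card_ord -[c' *+ (M ^ d)%N]mulr_natr -[c' *+ _]mulr_natr => c1.
by rewrite mulrAC ler_piMl.
Qed.

End Cells.

(** * Approximating an open set from inside by cells *)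

Section InnerApproximation.
Variables (R : realType) (d : nat).
Local Notation K := (adele_quot R).
Local Notation Kd := ('rV[K]_d).
Local Notation BKd := (g_sigma_algebraType (@open Kd)).
Local Open Scope complex_scope.

(** Small enough for the radius at level [n] to stay small after raising a
    character to any power up to [n!]. *)
Definition mesh_radius (n : nat) : R := (n.+1%:R * n`!%:R)^-1.

Lemma mesh_radius_gt0 n : 0 < mesh_radius n.
Proof. by rewrite invr_gt0 mulr_gt0 ?ltr0n ?fact_gt0. Qed.

Lemma norm_expB1 (z : R[i]) m : `|z| = 1 -> `|z ^+ m - 1| <= m%:R * `|z - 1|.
Proof.
move=> z1; rewrite subrX1 normrM mulrC ler_wpM2r //.
apply: le_trans (ler_norm_sum _ _ _) _.
under eq_bigr do rewrite normrX z1 expr1n.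
by rewrite sumr_const card_ord.
Qed.

(** A basic neighbourhood constrains the character at [l / N].  When [N]
    divides [n!], that value is a power with exponent [n! / N] of the value at
    [l / n!], hence [n! / N] times as far from [1] at most. *)
Lemma adele_quot_factorial_nbhs (U : set K) k : open U -> U k ->
  \forall n \near \oo, forall l,
    `|adele_char (n`!%:R^-1 *: l) - 1| < (2 * mesh_radius n)%:C -> U (k + l).
Proof.
move=> oU /(adele_quot_char_nbhs oU)[N [delta [N0 d0 NU]]].
exists (N + Num.truncn (2 / delta))%N => // n /= nlarge l lnear; apply: NU.
have nN : (N <= n)%N by apply: leq_trans nlarge; rewrite leq_addr.
have nd : 2 / n.+1%:R < delta.
  rewrite ltr_pdivrMr ?ltr0n // mulrC -ltr_pdivrMr //.
  apply: lt_le_trans (truncnS_gt _) _.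
  by rewrite ler_nat ltnS; apply: leq_trans nlarge; rewrite leq_addl.
pose m := (n`! %/ N)%N.
have mN : (m * N)%N = n`! by rewrite divnK // dvdn_fact // N0.
have N0' : N%:R != 0 :> rat by rewrite pnatr_eq0 -lt0n.
have m0' : m%:R != 0 :> rat.
  by rewrite pnatr_eq0; apply/eqP => m0; have := fact_gt0 n; rewrite -mN m0.
have -> : N%:R^-1 *: l = (n`!%:R^-1 *: l) *+ m.
  by rewrite -mN natrM invfM -scaler_nat scalerA mulVKf.
rewrite -adele_charMn; apply: le_lt_trans (norm_expB1 _ (norm_adele_char _)) _.
apply: (@le_lt_trans _ _ (n`!%:R * `|adele_char (n`!%:R^-1 *: l) - 1|)).
  by rewrite ler_wpM2r // ler_nat leq_div.
have f0 : 0 < n`!%:R :> R[i] by rewrite ltr0n fact_gt0.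
apply: (@lt_trans _ _ (n`!%:R * (2 * mesh_radius n)%:C)); first by rewrite ltr_pM2l.
rewrite -(rmorph_nat (real_complex R)) -rmorphM ltcR; apply: le_lt_trans nd.
rewrite /mesh_radius le_eqVlt; apply/orP; left; apply/eqP; field.
by rewrite nat1r !pnatr_eq0 -!lt0n fact_gt0.
Qed.

Lemma fine_mesh n (e : R) : 0 < e -> exists M : nat, [/\ (1 < M)%N,
  d%:R * (4 / (M%:R * mesh_radius n ^+ 2)) <= e &
  forall x : R, 0 <= x < M%:R^-1 -> `|unit_exp x - 1| < (mesh_radius n)%:C].
Proof.
move=> e0; have [eta eta0 etaP] := unit_exp_continuous0 (mesh_radius_gt0 n).
pose b := d%:R * 4 / (mesh_radius n ^+ 2 * e).
have r2 : 0 < mesh_radius n ^+ 2 by rewrite exprn_gt0 // mesh_radius_gt0.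
have b0 : 0 <= b by rewrite divr_ge0 ?mulr_ge0 ?(ltW (mesh_radius_gt0 n)) ?(ltW e0).
exists ((Num.truncn b).+1 + (Num.truncn eta^-1).+1)%N; set M := (_ + _)%N.
have M0 : 0 < M%:R :> R by rewrite ltr0n.
have Mb : b <= M%:R.
  by apply: le_trans (ltW (truncnS_gt b)) _; rewrite ler_nat leq_addr.
have Me : eta^-1 <= M%:R.
  by apply: le_trans (ltW (truncnS_gt _)) _; rewrite ler_nat leq_addl.
split; first by rewrite /M addSn addnS.
  move: Mb; rewrite /b ler_pdivrMr ?mulr_gt0 ?mesh_radius_gt0 // => Mb.
  rewrite mulrA ler_pdivrMr ?mulr_gt0 ?mesh_radius_gt0 //; apply: le_trans Mb _.
  by rewrite [e * _]mulrC mulrA.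
move=> x /andP[x0 xM]; apply: etaP; rewrite ger0_norm //.
by apply: lt_le_trans xM _; rewrite invf_ple ?posrE.
Qed.

Lemma torus_point_cell (N M : nat) (i : {ffun 'I_d -> 'I_M}) (k : Kd) j (delta : R) :
  (0 < M)%N ->
  (forall x : R, 0 <= x < M%:R^-1 -> `|unit_exp x - 1| < delta%:C) ->
  cell N i k -> `|torus_point N k j * grid_root R (i j) - 1| < delta%:C.
Proof.
move=> M0 small /(_ j)[a [/= ai /andP[a0 a1]] ak].
rewrite /torus_point -ak adele_charE // -unit_expD; apply: small.
by rewrite subr_ge0 a0 /= ltrBlDl; move: a1; rewrite -natr1 mulrDl mul1r.
Qed.

(** The triangle inequality through the grid point. *)
Lemma torus_point_quotient (N M : nat) (i : 'I_M) (k k' : Kd) j (delta : R) :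
  `|torus_point N k j * grid_root R i - 1| < delta%:C ->
  `|torus_point N k' j * grid_root R i - 1| < delta%:C ->
  `|adele_char (N%:R^-1 *: (k' 0 j - k 0 j)) - 1| < (2 * delta)%:C.
Proof.
move=> kd kd'; rewrite scalerBr adele_charD adele_charN -!/(torus_point _ _ _).
set z := torus_point N k j in kd *; set z' := torus_point N k' j in kd' *.
have z1 : `|z| = 1 by exact: norm_adele_char.
have z0 : z != 0 by rewrite -normr_gt0 z1.
have g1 : `|grid_root R i| = 1 by exact: norm_grid_root.
have -> : `|z' / z - 1| = `|(z' * grid_root R i - 1) - (z * grid_root R i - 1)|.
  have -> : z' * grid_root R i - 1 - (z * grid_root R i - 1) =
      (z' / z - 1) * (z * grid_root R i) by field.
  by rewrite [RHS]normrM normrM z1 g1 !mulr1.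
rewrite mulr_natl mulr2n rmorphD /=.
by apply: le_lt_trans (ler_normB _ _) _; exact: ltrD.
Qed.

Variable mu : probability BKd R.
Hypothesis haar : normalized_haar mu.

(** At level [n], select the cells whose grid point has its ball of radius
    [mesh_radius n] inside [U].  Every point of [U] lies in a selected cell at
    all large levels, so by continuity of the measure from below some level
    captures the measure of [U] up to [e]. *)
Lemma inner_cells (U : set Kd) (e : R) : open U -> 0 < e ->
  exists (N M : nat) (delta : R) (I : pred {ffun 'I_d -> 'I_M}),
  [/\ [/\ (0 < N)%N, (0 < M)%N & 0 < delta],
      d%:R * (4 / (M%:R * delta ^+ 2)) <= e,
      (forall i k, I i ->
        (forall j, `|torus_point N k j * grid_root R (i j) - 1| < delta%:C) -> U k) &
      (mu U <= (#|I|%:R / (M ^ d)%N%:R + e)%:E)%E].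
Proof.
move=> oU e0.
pose M n := projT1 (cid (fine_mesh n e0)).
have MP n : [/\ (1 < M n)%N, d%:R * (4 / ((M n)%:R * mesh_radius n ^+ 2)) <= e &
    forall x : R, 0 <= x < (M n)%:R^-1 -> `|unit_exp x - 1| < (mesh_radius n)%:C].
  by rewrite /M; case: cid.
pose I n : pred {ffun 'I_d -> 'I_(M n)} := fun i => `[< forall k,
  (forall j, `|torus_point n`! k j * grid_root R (i j) - 1| < (mesh_radius n)%:C) -> U k >].
pose W n : set Kd := \bigcup_(i in [set` I n]) cell n`! i.
pose V m : set Kd := \bigcap_(n in [set n | (m <= n)%N]) W n.
have mW n : measurable (W n : set BKd).
  apply: fin_bigcup_measurable => // i _; apply: measurable_cube.
    exact: fact_gt0.
  by have [] := MP n.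
have mV m : measurable (V m : set BKd).
  by apply: bigcap_measurable => [|n _ //]; exists m => /=.
have ndV : {homo V : n m / (n <= m)%N >-> (n <= m)%O}.
  move=> n m nm; apply/subsetPset => k Vk l /= ml; apply: Vk => /=.
  exact: leq_trans ml.
(* the finitely many coordinates share one level from which on the basic
   neighbourhoods of [k] fit inside [U] *)
have UV : U `<=` \bigcup_m V m.
  move=> k Uk; have : nbhs k U by exact: open_nbhs_nbhs.
  move=> [P kP PU].
  have : \forall n \near \oo, forall j, forall l,
    `|adele_char (n`!%:R^-1 *: l) - 1| < (2 * mesh_radius n)%:C -> P 0 j (k 0 j + l).
    apply: filter_forall => j.
    have := kP 0 j; rewrite nbhsE => -[B [oB Bk] BP].
    apply: filterS (adele_quot_factorial_nbhs oB Bk) => n nB l /nB; exact: BP.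
  move=> [m _ mP]; exists m => // n /= mn.
  have [M1 _ small] := MP n; have [i ik] := cell_cover n`! M1 k.
  exists i => //=; apply/asboolP => k' k'i; apply: PU => i0 j.
  rewrite (ord1 i0) -[k' 0 j](subrK (k 0 j)) addrC; apply: (mP n mn).
  apply: torus_point_quotient (k'i j); apply: torus_point_cell ik => //.
  exact: ltnW.
have mVU : measurable (\bigcup_m V m : set BKd) by exact: bigcup_measurable.
have mUV : (mu U <= mu (\bigcup_m V m))%E.
  by apply: le_measure; rewrite ?inE //; exact: measurable_open.
have [m mVm] : exists m, (mu (\bigcup_m V m) <= mu (V m) + e%:E)%E.
  apply: contrapT => /forallNP small.
  have cV := nondecreasing_cvg_mu (mu := mu) mV mVU ndV.
  have finV : mu (\bigcup_m V m) \is a fin_num by exact: fin_num_measure.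
  have : (lim (mu \o V @ \oo) <= mu (\bigcup_m V m) - e%:E)%E.
    apply: lime_le; first by apply/cvg_ex; eexists; exact: cV.
    apply: nearW => m; rewrite leeBrDr //; apply/ltW; rewrite ltNge; apply/negP; exact: small.
  rewrite (cvg_lim _ cV) // -[X in (X <= _)%E](fineK finV).
  by rewrite -[X in (_ <= X - _)%E](fineK finV) -EFinB lee_fin; lra.
exists m`!, (M m), (mesh_radius m), (I m); have [M1 Me _] := MP m; split=> //.
- by split; rewrite ?fact_gt0 ?mesh_radius_gt0 // ltnW.
- by move=> i k /asboolP; exact.
apply: le_trans mUV _; apply: le_trans mVm _; rewrite EFinD leeD2r //.
apply: le_trans (mu_cells (fact_gt0 m) M1 haar (I m)).
by apply: le_measure; rewrite ?inE; [exact: mV|exact: mW|move=> k Vk; exact: (Vk m (leqnn m))].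
Qed.

End InnerApproximation.

(** * From lower bounds to uniform distribution *)

Section Frequencies.
Variables (R : realType) (d : nat).
Local Notation K := (adele_quot R).
Local Notation Kd := ('rV[K]_d).
Local Notation BKd := (g_sigma_algebraType (@open Kd)).
Variables (mu : probability BKd R) (v : rat -> Kd).

Lemma frequency_disjoint (A : {fset rat}) (U W : set Kd) : U `&` W = set0 ->
  frequency v A U + frequency v A W <= 1.
Proof.
move=> UW; rewrite /frequency -mulrDl -natrD.
have [->|A0] := eqVneq #|` A| 0%N; first by rewrite invr0 mulr0.
rewrite ler_pdivrMr ?ltr0n ?lt0n // mul1r ler_nat -cardfsUI.
rewrite (_ : (_ `&` _)%fset = fset0) ?cardfs0 ?addn0; last first.
  apply/fsetP => t; rewrite !inE; apply/negP.
  move=> /andP[/andP[_ /set_mem Ut] /andP[_ /set_mem Wt]].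
  by have : (U `&` W) (v t) by []; rewrite UW.
apply: fsubset_leq_card; apply/fsubsetP => t; rewrite !inE.
by case/orP => /andP[].
Qed.

(** The lower bound for open sets applies to [U] and to the exterior of [U],
    which together have full measure. *)
Lemma uniformly_distributed_of_lower_bound (F : nat -> {fset rat}) :
  (forall (U : set Kd) (e : R), open U -> 0 < e ->
     \forall n \near \oo, fine (mu U) - e <= frequency v (F n) U) ->
  uniformly_distributed mu v F.
Proof.
move=> lower U oU bU0.
have mU : measurable (U : set BKd) by exact: measurable_open.
have oW : open (~` closure U) by apply: closed_openC; exact: closed_closure.
have mC : measurable (closure U : set BKd).
  by rewrite -[closure U]setCK; apply: measurableC; exact: measurable_open.
have muC : mu (closure U) = mu U.
  have -> : closure U = U `|` (closure U `\` U).
    by rewrite setDUK //; exact: subset_closure.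
  have UU : U `&` (closure U `\` U) = set0 by rewrite setDE setIC -setIA setICl setI0.
  rewrite [LHS](@measureU _ _ _ mu U (closure U `\` U)) //; last exact: measurableD.
  have intU : interior U = U by apply/interior_id.
  transitivity (mu U + 0)%E; last exact: adde0.
  by congr (_ + _)%E; rewrite -bU0 intU.
have muW : mu (~` closure U) = (1 - mu U)%E by rewrite probability_setC // muC.
have finU : mu U \is a fin_num by exact: fin_num_measure.
rewrite -(fineK finU); apply: cvg_EFin; first exact: nearW.
apply/cvgrPdist_le => e e0 /=.
apply: filterS2 (lower U e oU e0) (lower _ e oW e0) => n lU.
rewrite muW -(fineK finU) -EFinB /= => lW.
have UW : U `&` ~` closure U = set0.
  by apply/seteqP; split=> // k [Uk]; apply; exact: subset_closure.
have := frequency_disjoint (F n) UW; rewrite ler_distl /frequency in lU lW *.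
by move=> sum1; apply/andP; split; lra.
Qed.

End Frequencies.

Theorem theorem5p2 (R : realType) (d : nat)
    (mu : probability (g_sigma_algebraType (@open 'rV[adele_quot R]_d)) R)
    (g : 'I_d -> rat -> adele_quot R) :
  normalized_haar mu ->
  (forall j, polynomial_map (g j)) ->
  (forall n : 'rV[rat]_d, n != 0 ->
     ~ exists c : adele_quot R, forall x, \sum_(j < d) n 0 j *: g j x = c) ->
  well_distributed mu (fun x => \row_(j < d) g j x).
Proof.
move=> haar gpoly gnc F folF; set v := fun x => _.
have weylv (n : 'rV[rat]_d) : n != 0 -> vanishing (fun N =>
    mean (F N) (fun t => adele_char (\sum_j n 0 j *: v t 0 j))).
  move=> n0; have vE t : \sum_j n 0 j *: v t 0 j = \sum_j n 0 j *: g j t.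
    by apply: eq_bigr => j _; rewrite mxE.
  apply: (nonconstant_phase_vanishing folF); last first.
    by move=> [c cP]; apply: (gnc n n0); exists c => x; rewrite -vE.
  under eq_fun do rewrite vE.
  by apply: polynomial_map_sum => j; exact: polynomial_mapZ.
apply: uniformly_distributed_of_lower_bound => U e oU e0.
have e3 : 0 < e / 3 by rewrite divr_gt0.
have [N [M [delta [I [[N0 M0 d0] err IU muU]]]]] := inner_cells haar oU e3.
apply: filterS (frequency_lower_bound folF weylv N0 M0 d0 e3 IU) => n.
apply: le_trans; have : fine (mu U) <= #|I|%:R / (M ^ d)%N%:R + e / 3.
  rewrite -lee_fin fineK //; apply: fin_num_measure; exact: measurable_open.
lra.
Qed.
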